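(* Let $R$ be a ring, let $(P,Q,\psi)$ be an $R$-system satisfying condition (FS), let $J$ be a two-sided ideal of $R$ such that $J\subseteq\Delta^{-1}(\mathcal{F}_P(Q))$ and $J\cap\ker\Delta=\{0\}$, and let $(S,T,\sigma,B)$ be a covariant representation of $(P,Q,\psi)$. Then: (1) If there exists a ring homomorphism $\eta:\mathcal{O}_{(P,Q,\psi)}(J)\to B$ such that $\eta\circ\iota_Q^J=T$, $\eta\circ\iota_P^J=S$ and $\eta\circ\iota_R^J=\sigma$, then the representation $(S,T,\sigma,B)$ is Cuntz-Pimsner invariant with respect to $J$. (2) If the representation $(S,T,\sigma,B)$ is Cuntz-Pimsner invariant with respect to $J$, then there exists a unique ring homomorphism $\eta^J_{(S,T,\sigma,B)}:\mathcal{O}_{(P,Q,\psi)}(J)\to B$ such that $\eta^J_{(S,T,\sigma,B)}\circ\iota_Q^J=T$, $\eta^J_{(S,T,\sigma,B)}\circ\iota_P^J=S$ and $\eta^J_{(S,T,\sigma,B)}\circ\iota_R^J=\sigma$. (3) If the representation $(S,T,\sigma,B)$ is Cuntz-Pimsner invariant with respect to $J$, then the ring homomorphism $\eta^J_{(S,T,\sigma,B)}$ is an isomorphism if and only if $(S,T,\sigma,B)$ is surjective, injective and graded and $J=J_{(S,T,\sigma,B)}$.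
   Context: Rings are associative, not necessarily unital. For $R$-bimodules $P,Q$, $P\otimes Q$ is the $R$-balanced tensor product. ''Linear'' means additive. An $R$-system is a triple $(P,Q,\psi)$ where $P,Q$ are $R$-bimodules and $\psi:P\otimes Q\to R$ is an $R$-bimodule homomorphism. A covariant representation of $(P,Q,\psi)$ is a quadruple $(S,T,\sigma,B)$ where $B$ is a ring, $S:P\to B$ and $T:Q\to B$ are linear maps, $\sigma:R\to B$ is a ring homomorphism, and $S(pr)=S(p)\sigma(r)$, $S(rp)=\sigma(r)S(p)$, $T(qr)=T(q)\sigma(r)$, $T(rq)=\sigma(r)T(q)$, $\sigma(\psi(p\otimes q))=S(p)T(q)$ for all $r\in R,p\in P,q\in Q$. It is surjective if $B$ is generated as a ring by $\sigma(R)\cup T(Q)\cup S(P)$, injective if $\sigma$ is injective. A surjective covariant representation is graded if $B$ has a $\mathbb{Z}$-grading $\bigoplus_{n}B^{(n)}$ with $\sigma(R)\subseteq B^{(0)}$, $T(Q)\subseteq B^{(1)}$, $S(P)\subseteq B^{(-1)}$. The Toeplitz representation $(\iota_P,\iota_Q,\iota_R,\mathcal{T}_{(P,Q,\psi)})$ is the (up to isomorphism unique) surjective covariant representation such that for every covariant representation $(S,T,\sigma,B)$ there is a unique ring homomorphism $\eta:\mathcal{T}_{(P,Q,\psi)}\to B$ with $\eta\circ\iota_R=\sigma$, $\eta\circ\iota_Q=T$, $\eta\circ\iota_P=S$; it exists and is injective. For $p\in P,q\in Q$: $\theta_{q,p}:Q\to Q$, $x\mapsto q\psi(p\otimes x)$,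 and $\theta_{p,q}:P\to P$, $y\mapsto\psi(y\otimes q)p$. $\mathcal{F}_P(Q)$ is the additive span of all $\theta_{q,p}$, $\mathcal{F}_Q(P)$ the additive span of all $\theta_{p,q}$. Condition (FS): for all finite sets $\{q_1,\dots,q_n\}\subseteq Q$, $\{p_1,\dots,p_m\}\subseteq P$ there exist $\Theta\in\mathcal{F}_P(Q)$ and $\Omega\in\mathcal{F}_Q(P)$ with $\Theta(q_i)=q_i$ and $\Omega(p_j)=p_j$ for all $i,j$. $\Delta:R\to\operatorname{End}(Q_R)$ is the ring homomorphism $\Delta(r)(q)=rq$. Under (FS), every covariant representation $(S,T,\sigma,B)$ induces a unique ring homomorphism $\pi_{T,S}:\mathcal{F}_P(Q)\to B$ with $\pi_{T,S}(\theta_{q,p})=T(q)S(p)$; put $\pi=\pi_{\iota_Q,\iota_P}$. Define $J_{(S,T,\sigma,B)}:=\{r\in R:\sigma(r)\in\pi_{T,S}(\mathcal{F}_P(Q))\}$. For a two-sided ideal $J\subseteq\Delta^{-1}(\mathcal{F}_P(Q))$, $\mathcal{T}(J)$ is the two-sided ideal of $\mathcal{T}_{(P,Q,\psi)}$ generated by $\{\iota_R(x)-\pi(\Delta(x)):x\in J\}$, $\mathcal{O}_{(P,Q,\psi)}(J):=\mathcal{T}_{(P,Q,\psi)}/\mathcal{T}(J)$ with quotient map $\rho_J$, and $\iota_R^J=\rho_J\circ\iota_R$, $\iota_Q^J=\rho_J\circ\iota_Q$, $\iota_P^J=\rho_J\circ\iota_P$. A covariant representation $(S,T,\sigma,B)$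 is Cuntz-Pimsner invariant with respect to (relative to) $J$ if $\pi_{T,S}(\Delta(x))=\sigma(x)$ for every $x\in J$. *)

(* Defs.v *)
From HB Require Import structures.
From mathcomp Require Import all_boot all_order all_algebra.
From mathcomp Require Import ring_quotient.
From mathcomp Require Import boolp classical_sets functions cardinality fsbigop.

Set Implicit Arguments.
Unset Strict Implicit.
Unset Printing Implicit Defensive.

Import GRing.Theory.

Local Open Scope classical_set_scope.
Local Open Scope ring_scope.

(* Associative rings, not necessarily unital.  Every MathComp ring structure
   has a 1, so the structure is built on zmodType. *)
HB.mixin Record Zmodule_isRng R of GRing.Zmodule R := {
  rmul : R -> R -> R;
  rmulA : associative rmul;
  rmulDl : left_distributive rmul +%R;
  rmulDr : right_distributive rmul +%R
}.

#[short(type="rngType")]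
HB.structure Definition Rng := {R of Zmodule_isRng R & GRing.Zmodule R}.

Notation "x ** y" := (rmul x y) (at level 40, left associativity) : ring_scope.

HB.mixin Record Zmodule_isBimodule (R : rngType) M of GRing.Zmodule M := {
  lact : R -> M -> M;
  ract : M -> R -> M;
  lactDl : forall r s x, lact (r + s) x = lact r x + lact s x;
  lactDr : forall r x y, lact r (x + y) = lact r x + lact r y;
  lactM : forall r s x, lact (r ** s) x = lact r (lact s x);
  ractDl : forall x y r, ract (x + y) r = ract x r + ract y r;
  ractDr : forall x r s, ract x (r + s) = ract x r + ract x s;
  ractM : forall x r s, ract x (r ** s) = ract (ract x r) s;
  lractA : forall r x s, ract (lact r x) s = lact r (ract x s)
}.

#[short(type="bimodType")]
HB.structure Definition Bimodule (R : rngType) :=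
  {M of Zmodule_isBimodule R M & GRing.Zmodule M}.

Section RngTheory.
Variable R : rngType.
Implicit Types x y z : R.

Lemma rmul0r x : 0 ** x = 0.
Proof. by apply: (addrI (0 ** x)); rewrite -rmulDl !addr0. Qed.

Lemma rmulr0 x : x ** 0 = 0.
Proof. by apply: (addrI (x ** 0)); rewrite -rmulDr !addr0. Qed.

Lemma rmulNr x y : - x ** y = - (x ** y).
Proof. by apply/eqP; rewrite -addr_eq0 -rmulDl addNr rmul0r. Qed.

Lemma rmulrN x y : x ** - y = - (x ** y).
Proof. by apply/eqP; rewrite -addr_eq0 -rmulDr addNr rmulr0. Qed.

Lemma rmulBl x y z : (x - y) ** z = x ** z - y ** z.
Proof. by rewrite rmulDl rmulNr. Qed.

Lemma rmulBr x y z : x ** (y - z) = x ** y - x ** z.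
Proof. by rewrite rmulDr rmulrN. Qed.

End RngTheory.

Section BimoduleTheory.
Variables (R : rngType) (M : bimodType R).
Implicit Types (r : R) (x y : M).

Lemma lact0r x : lact (0 : R) x = 0.
Proof. by apply: (addrI (lact (0 : R) x)); rewrite -lactDl !addr0. Qed.

Lemma lactr0 r : lact r (0 : M) = 0.
Proof. by apply: (addrI (lact r (0 : M))); rewrite -lactDr !addr0. Qed.

Lemma lactrN r x : lact r (- x) = - lact r x.
Proof. by apply/eqP; rewrite -addr_eq0 -lactDr addNr lactr0. Qed.

Lemma ract0r r : ract (0 : M) r = 0.
Proof. by apply: (addrI (ract (0 : M) r)); rewrite -ractDl !addr0. Qed.

Lemma ractr0 x : ract x (0 : R) = 0.
Proof. by apply: (addrI (ract x (0 : R))); rewrite -ractDr !addr0. Qed.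

Lemma ractNr x r : ract (- x) r = - ract x r.
Proof. by apply/eqP; rewrite -addr_eq0 -ractDl addNr ract0r. Qed.

End BimoduleTheory.

Section ZmodMorphism.
Variables (U V : zmodType) (f : U -> V).
Hypothesis fB : zmod_morphism f.

Lemma zmor0 : f 0 = 0. Proof. by rewrite -(subrr 0) fB subrr. Qed.
Lemma zmorN x : f (- x) = - f x. Proof. by rewrite -sub0r fB zmor0 sub0r. Qed.
Lemma zmorD x y : f (x + y) = f x + f y.
Proof. by rewrite -[y in LHS]opprK fB zmorN opprK. Qed.
Lemma zmor_sum I (s : seq I) (F : I -> U) :
  f (\sum_(i <- s) F i) = \sum_(i <- s) f (F i).
Proof.
by elim: s => [|i s IHs]; rewrite ?big_nil ?zmor0// !big_cons zmorD IHs.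
Qed.

End ZmodMorphism.

(* Ring homomorphisms need not preserve a unit, even when there is one. *)
Definition rng_hom (A B : rngType) (f : A -> B) : Prop :=
  zmod_morphism f /\ {morph f : x y / x ** y}.

Definition subgroup (A : zmodType) (H : set A) : Prop :=
  H 0 /\ forall x y, H x -> H y -> H (x - y).

Definition subrng (A : rngType) (H : set A) : Prop :=
  subgroup H /\ forall x y, H x -> H y -> H (x ** y).

Definition two_sided_ideal (A : rngType) (I : set A) : Prop :=
  subgroup I /\ forall a x, I x -> I (a ** x) /\ I (x ** a).

Definition additive_span (A : zmodType) (G : set A) : set A :=
  smallest (@subgroup A) G.
Definition rng_span (A : rngType) (G : set A) : set A :=
  smallest (@subrng A) G.
Definition ideal_span (A : rngType) (G : set A) : set A :=
  smallest (@two_sided_ideal A) G.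

Lemma subgroup_span (A : zmodType) (G : set A) : subgroup (additive_span G).
Proof.
split=> [I [[]]//|x y Ix Iy I IG]; have [[_ IB] _] := IG.
by apply: IB; [apply: Ix | apply: Iy].
Qed.

Lemma two_sided_ideal_span (A : rngType) (G : set A) :
  two_sided_ideal (ideal_span G).
Proof.
split=> [|a x Ix].
  split=> [I [[[]]]//|x y Ix Iy I IG]; have [[[_ IB] _] _] := IG.
  by apply: IB; [apply: Ix | apply: Iy].
by split=> I IG; have [[_ IM] _] := IG; have [] := IM a x (Ix I IG).
Qed.

(* The quotient of A by the two-sided ideal generated by G. *)
Section RngQuotient.
Variables (A : rngType) (G : set A).
Local Open Scope quotient_scope.

Definition ideal_pred : {pred A} := fun x => `[< ideal_span G x >].

Lemma ideal_predP x : reflect (ideal_span G x) (x \in ideal_pred).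
Proof. exact: asboolP. Qed.

Fact ideal_pred_closed : zmod_closed ideal_pred.
Proof.
have [[I0 IB] _] := two_sided_ideal_span G.
by split=> [|x y /ideal_predP Ix /ideal_predP Iy]; apply/ideal_predP; auto.
Qed.

HB.instance Definition _ := GRing.isZmodClosed.Build A ideal_pred
  ideal_pred_closed.

Definition rng_quot := Quotient.quot ideal_pred.
HB.instance Definition _ := GRing.Zmodule.on rng_quot.
HB.instance Definition _ := Quotient.on rng_quot.

Definition to_quot (x : A) : rng_quot := \pi_rng_quot x.

Lemma to_quot_eq x y : to_quot x = to_quot y <-> ideal_span G (x - y).
Proof.
rewrite /to_quot; split=> [/eqP|]; first by rewrite -Quotient.idealrBE => /ideal_predP.
by move=> h; apply/eqP; rewrite -Quotient.idealrBE; apply/ideal_predP.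
Qed.

Lemma to_quotK x : to_quot (repr x) = x. Proof. exact: reprK. Qed.

Lemma to_quotB : zmod_morphism to_quot.
Proof. by move=> x y; rewrite /to_quot !piE. Qed.

Lemma to_quotD : {morph to_quot : x y / x + y}.
Proof. by move=> x y; rewrite /to_quot !piE. Qed.

Definition quot_mul (x y : rng_quot) : rng_quot := to_quot (repr x ** repr y).

Lemma to_quotM x y : to_quot (x ** y) = quot_mul (to_quot x) (to_quot y).
Proof.
apply/to_quot_eq; set x' := repr _; set y' := repr _.
have [[I0 IB] IM] := two_sided_ideal_span G.
have Ix : ideal_span G (x - x') by apply/to_quot_eq; rewrite to_quotK.
have Iy : ideal_span G (y' - y) by apply/to_quot_eq; rewrite to_quotK.
have -> : x ** y - x' ** y' = (x - x') ** y - x' ** (y' - y).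
  by rewrite rmulBl rmulBr opprB addrA subrK.
by apply: IB; [apply: (IM _ _ Ix).2 | apply: (IM _ _ Iy).1].
Qed.

Fact quot_mulA : associative quot_mul.
Proof.
move=> x y z; rewrite -[x]to_quotK -[y]to_quotK -[z]to_quotK.
by rewrite -!to_quotM rmulA.
Qed.

Fact quot_mulDl : left_distributive quot_mul +%R.
Proof.
move=> x y z; rewrite -[x]to_quotK -[y]to_quotK -[z]to_quotK.
by rewrite -to_quotD -!to_quotM -to_quotD rmulDl.
Qed.

Fact quot_mulDr : right_distributive quot_mul +%R.
Proof.
move=> x y z; rewrite -[x]to_quotK -[y]to_quotK -[z]to_quotK.
by rewrite -to_quotD -!to_quotM -to_quotD rmulDr.
Qed.

HB.instance Definition _ := Zmodule_isRng.Build rng_quot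
  quot_mulA quot_mulDl quot_mulDr.

Lemma to_quot_hom : rng_hom to_quot.
Proof. by split; [exact: to_quotB | exact: to_quotM]. Qed.

End RngQuotient.

(* The R-balanced tensor product P (x) Q: finite formal sums of pairs modulo
   the congruence generated by biadditivity and balancedness.  A list of pairs
   stands for the sum of the corresponding pure tensors; opposites are
   obtained by negating first components. *)
Section Tensor.
Variables (R : rngType) (P Q : bimodType R).

Inductive tensor_eqv : seq (P * Q) -> seq (P * Q) -> Prop :=
| TensorRefl s : tensor_eqv s s
| TensorSym s t : tensor_eqv s t -> tensor_eqv t s
| TensorTrans s t u : tensor_eqv s t -> tensor_eqv t u -> tensor_eqv s u
| TensorCat s s' t t' :
    tensor_eqv s s' -> tensor_eqv t t' -> tensor_eqv (s ++ t) (s' ++ t')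
| TensorComm s t : tensor_eqv (s ++ t) (t ++ s)
| TensorZerol q : tensor_eqv [:: (0, q)] [::]
| TensorAddl p p' q : tensor_eqv [:: (p + p', q)] [:: (p, q); (p', q)]
| TensorAddr p q q' : tensor_eqv [:: (p, q + q')] [:: (p, q); (p, q')]
| TensorBalance p r q :
    tensor_eqv [:: (ract p r, q)] [:: (p, lact r q)].

Definition tensor_eqb (s t : seq (P * Q)) : bool := `[< tensor_eqv s t >].

Fact tensor_eqb_equiv : equiv_class_of tensor_eqb.
Proof.
split=> [s|s t|t s u]; first by apply/asboolP; constructor.
  by apply/asboolP/asboolP; apply: TensorSym.
by move=> /asboolP st /asboolP tu; apply/asboolP; apply: TensorTrans tu.
Qed.

Canonical tensor_equiv := EquivRelPack tensor_eqb_equiv.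

Definition tensor := {eq_quot tensor_eqb}%qT.
HB.instance Definition _ := Choice.on tensor.

Definition tsum (s : seq (P * Q)) : tensor := (\pi_tensor s)%qT.
Definition tpure (p : P) (q : Q) : tensor := tsum [:: (p, q)].

Lemma tsum_eq s t : tsum s = tsum t <-> tensor_eqv s t.
Proof.
split=> [/eqP|st]; first by rewrite /tsum piE => /asboolP.
by apply/eqP; rewrite /tsum piE; apply/asboolP.
Qed.

Lemma tsumK t : tsum (repr t) = t. Proof. exact: reprK. Qed.

Lemma tsum_repr s : tensor_eqv (repr (tsum s)) s.
Proof. by apply/tsum_eq; rewrite tsumK. Qed.

Definition tmap (f : P * Q -> P * Q) (t : tensor) : tensor :=
  tsum (map f (repr t)).

Lemma tensor_eqv_map (f : P -> P) (g : Q -> Q) :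
    {morph f : x y / x + y} -> {morph g : x y / x + y} ->
    (forall p r q, tensor_eqv [:: (f (ract p r), g q)] [:: (f p, g (lact r q))]) ->
  forall s t, tensor_eqv s t ->
    tensor_eqv [seq (f x.1, g x.2) | x <- s] [seq (f x.1, g x.2) | x <- t].
Proof.
move=> fD gD fg s t.
elim=> {s t} /=.
- by move=> s; apply: TensorRefl.
- by move=> s t _; apply: TensorSym.
- by move=> s t u _ + _; apply: TensorTrans.
- by move=> s s' t t' _ IHs _ IHt; rewrite !map_cat; apply: TensorCat.
- by move=> s t; rewrite !map_cat; apply: TensorComm.
- move=> q; have -> : f 0 = 0 by apply: (addrI (f 0)); rewrite -fD !addr0.
  exact: TensorZerol.
- by move=> p p' q; rewrite fD; apply: TensorAddl.
- by move=> p q q'; rewrite gD; apply: TensorAddr.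
- by move=> p r q; apply: fg.
Qed.

Lemma tmap_tsum (f : P -> P) (g : Q -> Q) :
    {morph f : x y / x + y} -> {morph g : x y / x + y} ->
    (forall p r q, tensor_eqv [:: (f (ract p r), g q)] [:: (f p, g (lact r q))]) ->
  forall s, tmap (fun x => (f x.1, g x.2)) (tsum s)
            = tsum [seq (f x.1, g x.2) | x <- s].
Proof.
move=> fD gD fg s; apply/tsum_eq.
by apply: tensor_eqv_map => //; apply: tsum_repr.
Qed.

Definition tadd (x y : tensor) : tensor := tsum (repr x ++ repr y).
Definition topp : tensor -> tensor := tmap (fun x => (- x.1, x.2)).
Definition tlact (r : R) : tensor -> tensor :=
  tmap (fun x => (lact r x.1, x.2)).
Definition tract (t : tensor) (r : R) : tensor :=
  tmap (fun x => (x.1, ract x.2 r)) t.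

Lemma tsum_cat s t : tsum (s ++ t) = tadd (tsum s) (tsum t).
Proof.
by apply/tsum_eq/TensorSym; apply: TensorCat; apply: tsum_repr.
Qed.

Lemma topp_tsum s : topp (tsum s) = tsum [seq (- x.1, x.2) | x <- s].
Proof.
apply: (@tmap_tsum -%R id) => //; first exact: opprD.
by move=> p r q; rewrite -ractNr; apply: TensorBalance.
Qed.

Lemma tlact_tsum r s : tlact r (tsum s) = tsum [seq (lact r x.1, x.2) | x <- s].
Proof.
apply: (@tmap_tsum (lact r) id) => //; first exact: lactDr.
by move=> p a q; rewrite -lractA; apply: TensorBalance.
Qed.

Lemma tract_tsum s r : tract (tsum s) r = tsum [seq (x.1, ract x.2 r) | x <- s].
Proof.
apply: (@tmap_tsum id (fun q => ract q r)) => //.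
  by move=> x y; apply: ractDl.
by move=> p a q; rewrite lractA; apply: TensorBalance.
Qed.

Fact taddA : associative tadd.
Proof.
move=> x y z; rewrite -[x]tsumK -[y]tsumK -[z]tsumK.
by rewrite -!tsum_cat catA.
Qed.

Fact taddC : commutative tadd.
Proof.
move=> x y; rewrite -[x]tsumK -[y]tsumK -!tsum_cat.
by apply/tsum_eq; apply: TensorComm.
Qed.

Fact tadd0 : left_id (tsum [::]) tadd.
Proof. by move=> x; rewrite -[x]tsumK -tsum_cat. Qed.

Fact taddN : left_inverse (tsum [::]) topp tadd.
Proof.
move=> x; rewrite -[x]tsumK; elim: (repr x) => [|[p q] s IHs].
  by rewrite topp_tsum -tsum_cat.
rewrite topp_tsum /= -cat1s -[(p, q) :: s]cat1s !tsum_cat -topp_tsum.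
rewrite [tadd (tsum [:: _]) (topp _)]taddC -taddA.
rewrite [tadd (tsum [:: (- p, q)]) _]taddA -tsum_cat /=.
have -> : tsum [:: (- p, q); (p, q)] = tsum [::].
  apply/tsum_eq; apply: TensorTrans (TensorZerol q); rewrite -(addNr p).
  exact/TensorSym/TensorAddl.
by rewrite tadd0.
Qed.

HB.instance Definition _ := GRing.isZmodule.Build tensor
  taddA taddC tadd0 taddN.

Lemma tsumD s t : tsum (s ++ t) = tsum s + tsum t.
Proof. exact: tsum_cat. Qed.

Lemma tsumE s : tsum s = \sum_(x <- s) tpure x.1 x.2.
Proof.
elim: s => [|[p q] s IHs]; first by rewrite big_nil.
by rewrite big_cons -cat1s tsumD IHs.
Qed.

Lemma tpureDl p p' q : tpure (p + p') q = tpure p q + tpure p' q.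
Proof. by rewrite /tpure -tsumD; apply/tsum_eq; apply: TensorAddl. Qed.

Lemma tpureDr p q q' : tpure p (q + q') = tpure p q + tpure p q'.
Proof. by rewrite /tpure -tsumD; apply/tsum_eq; apply: TensorAddr. Qed.

Lemma tpure_balanced p r q : tpure (ract p r) q = tpure p (lact r q).
Proof. by apply/tsum_eq; apply: TensorBalance. Qed.

Lemma tensor_ind (K : tensor -> Prop) :
    K 0 -> (forall p q t, K t -> K (tpure p q + t)) -> forall t, K t.
Proof.
move=> K0 KD t; rewrite -[t]tsumK; elim: (repr t) => [//|[p q] s IHs].
by rewrite -cat1s tsumD; apply: KD.
Qed.

Lemma tlactD r x y : tlact r (x + y) = tlact r x + tlact r y.
Proof.
by rewrite -[x]tsumK -[y]tsumK -tsumD !tlact_tsum map_cat tsumD.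
Qed.

Lemma tractD x y r : tract (x + y) r = tract x r + tract y r.
Proof.
by rewrite -[x]tsumK -[y]tsumK -tsumD !tract_tsum map_cat tsumD.
Qed.

Lemma tlact_pure r p q : tlact r (tpure p q) = tpure (lact r p) q.
Proof. exact: tlact_tsum. Qed.

Lemma tract_pure p q r : tract (tpure p q) r = tpure p (ract q r).
Proof. exact: tract_tsum. Qed.

Lemma tlact0 r : tlact r 0 = 0. Proof. exact: (tlact_tsum r [::]). Qed.
Lemma tract0 r : tract 0 r = 0. Proof. exact: (tract_tsum [::] r). Qed.

Fact tlactDl r s x : tlact (r + s) x = tlact r x + tlact s x.
Proof.
elim/tensor_ind: x => [|p q t IH]; first by rewrite !tlact0 addr0.
by rewrite !tlactD IH !tlact_pure lactDl tpureDl addrACA.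
Qed.

Fact tlactM r s x : tlact (r ** s) x = tlact r (tlact s x).
Proof.
elim/tensor_ind: x => [|p q t IH]; first by rewrite !tlact0.
by rewrite !tlactD IH !tlact_pure lactM.
Qed.

Fact tractDr x r s : tract x (r + s) = tract x r + tract x s.
Proof.
elim/tensor_ind: x => [|p q t IH]; first by rewrite !tract0 addr0.
by rewrite !tractD IH !tract_pure ractDr tpureDr addrACA.
Qed.

Fact tractM x r s : tract x (r ** s) = tract (tract x r) s.
Proof.
elim/tensor_ind: x => [|p q t IH]; first by rewrite !tract0.
by rewrite !tractD IH !tract_pure ractM.
Qed.

Fact tlractA r x s : tract (tlact r x) s = tlact r (tract x s).
Proof.
elim/tensor_ind: x => [|p q t IH]; first by rewrite tlact0 !tract0 tlact0.
by rewrite !(tlactD, tractD) IH !(tlact_pure, tract_pure).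
Qed.

HB.instance Definition _ := Zmodule_isBimodule.Build R tensor
  tlactDl tlactD tlactM tractD tractDr tractM tlractA.

End Tensor.

Section Systems.
Variables (R : rngType) (P Q : bimodType R).

(* (P, Q, psi) is an R-system: psi is an R-bimodule homomorphism to R. *)
Definition is_system (psi : tensor P Q -> R) : Prop :=
  [/\ zmod_morphism psi,
      forall r t, psi (lact r t) = r ** psi t
    & forall t r, psi (ract t r) = psi t ** r].

Variable psi : tensor P Q -> R.

Record covariant_rep (B : rngType) (S : P -> B) (T : Q -> B) (sigma : R -> B)
    : Prop := CovariantRep {
  rep_S : zmod_morphism S;
  rep_T : zmod_morphism T;
  rep_sigma : rng_hom sigma;
  rep_Sract : forall p r, S (ract p r) = S p ** sigma r;
  rep_Slact : forall r p, S (lact r p) = sigma r ** S p;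
  rep_Tract : forall q r, T (ract q r) = T q ** sigma r;
  rep_Tlact : forall r q, T (lact r q) = sigma r ** T q;
  rep_psi : forall p q, sigma (psi (tpure p q)) = S p ** T q
}.

Definition surjective_rep (B : rngType) (S : P -> B) (T : Q -> B)
    (sigma : R -> B) : Prop :=
  rng_span (range sigma `|` range T `|` range S) = [set: B].

Definition injective_rep (B : rngType) (sigma : R -> B) : Prop :=
  injective sigma.

(* B is the internal direct sum of the subgroups G n, and G m G n <= G (m+n). *)
Definition is_grading (B : rngType) (G : int -> set B) : Prop :=
  [/\ forall n, subgroup (G n),
      forall b, exists! d : int -> B,
        [/\ forall n, G n (d n), finite_set [set n | d n != 0]
          & b = \sum_(n \in [set: int]) d n]
    & forall m n x y, G m x -> G n y -> G (m + n) (x ** y)].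

Definition graded_rep (B : rngType) (S : P -> B) (T : Q -> B)
    (sigma : R -> B) : Prop :=
  exists G : int -> set B,
    [/\ is_grading G, range sigma `<=` G 0, range T `<=` G 1
      & range S `<=` G (-1)].

Definition is_toeplitz (A : rngType) (iP : P -> A) (iQ : Q -> A)
    (iR : R -> A) : Prop :=
  [/\ covariant_rep iP iQ iR, surjective_rep iP iQ iR
    & forall (B : rngType) (S : P -> B) (T : Q -> B) (sigma : R -> B),
        covariant_rep S T sigma ->
        exists! eta : A -> B,
          [/\ rng_hom eta, eta \o iR = sigma, eta \o iQ = T & eta \o iP = S]].

Definition theta_Q (q : Q) (p : P) : Q -> Q := fun x => ract q (psi (tpure p x)).
Definition theta_P (p : P) (q : Q) : P -> P := fun y => lact (psi (tpure y q)) p.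

(* F_P(Q) and F_Q(P), as sets of maps; sums are pointwise and the product of
   F_P(Q) is composition. *)
Definition F_PQ : set (Q -> Q) :=
  additive_span [set f | exists q p, f = theta_Q q p].
Definition F_QP : set (P -> P) :=
  additive_span [set f | exists p q, f = theta_P p q].

Definition cond_FS : Prop :=
  forall (qs : seq Q) (ps : seq P), exists Theta Omega,
    [/\ F_PQ Theta, F_QP Omega, {in qs, forall q, Theta q = q}
      & {in ps, forall p, Omega p = p}].

Definition Delta (r : R) : Q -> Q := lact r.

Section Pi.
Variables (B : rngType) (S : P -> B) (T : Q -> B).

(* pi restricts to a ring homomorphism F_P(Q) -> B sending each theta_{q,p} to
   T(q)S(p); its values outside F_P(Q) are irrelevant. *)
Definition is_pi (pi : (Q -> Q) -> B) : Prop :=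
  [/\ forall f g, F_PQ f -> F_PQ g -> pi (f - g) = pi f - pi g,
      forall f g, F_PQ f -> F_PQ g -> pi (f \o g) = pi f ** pi g
    & forall q p, pi (theta_Q q p) = T q ** S p].

(* Well defined on F_P(Q) under condition (FS): see pi_TSP and is_pi_unique. *)
Definition pi_TS : (Q -> Q) -> B := xget (fun=> 0) [set pi | is_pi pi].

End Pi.

Section PiTheory.
Variables (B : rngType) (S : P -> B) (T : Q -> B) (sigma : R -> B).
Hypotheses (psi_sys : is_system psi) (FS : cond_FS).
Hypothesis rep : covariant_rep S T sigma.

Let thetas (s : seq (Q * P)) : Q -> Q := \sum_(x <- s) theta_Q x.1 x.2.
Let TSs (s : seq (Q * P)) : B := \sum_(x <- s) T x.1 ** S x.2.

Lemma F_PQ_theta q p : F_PQ (theta_Q q p).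
Proof. by apply: sub_gen_smallest; exists q, p. Qed.

Let SB : zmod_morphism S := rep_S rep.
Let TB : zmod_morphism T := rep_T rep.
Let psi_additive : zmod_morphism psi := let: And3 h _ _ := psi_sys in h.

Let thetas_cat s t : thetas (s ++ t) = thetas s + thetas t.
Proof. exact: big_cat. Qed.

Let TSs_cat s t : TSs (s ++ t) = TSs s + TSs t.
Proof. exact: big_cat. Qed.

Let thetasN s : thetas [seq (- x.1, x.2) | x <- s] = - thetas s.
Proof.
rewrite /thetas big_map -sumrN; apply: eq_bigr => x _.
by apply/funext => y; rewrite /theta_Q ractNr.
Qed.

Let TSsN s : TSs [seq (- x.1, x.2) | x <- s] = - TSs s.
Proof.
rewrite /TSs big_map -sumrN; apply: eq_bigr => x _.
by rewrite (zmorN TB) rmulNr.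
Qed.

Lemma F_PQP f : F_PQ f -> exists s : seq (Q * P), f = \sum_(x <- s) theta_Q x.1 x.2.
Proof.
apply: (@smallest_sub _ _ _ [set f | exists s, f = thetas s]).
  split=> [|_ _ [s ->] [t ->]]; first by exists [::]; rewrite /thetas big_nil.
  exists (s ++ [seq (- x.1, x.2) | x <- t]).
  by rewrite -thetasN -thetas_cat.
by move=> _ [q [p ->]]; exists [:: (q, p)]; rewrite /thetas big_seq1.
Qed.

Let F_QPP f : F_QP f ->
  exists s : seq (P * Q), f = \sum_(x <- s) theta_P x.1 x.2.
Proof.
apply: (@smallest_sub _ _ _
  [set f | exists s : seq (P * Q), f = \sum_(x <- s) theta_P x.1 x.2]).
  split=> [|_ _ [s ->] [t ->]]; first by exists [::]; rewrite big_nil.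
  exists (s ++ [seq (- x.1, x.2) | x <- t]).
  rewrite big_cat /= big_map -sumrN; congr (_ + _); apply: eq_bigr => x _.
  by apply/funext => y; rewrite /theta_P lactrN.
by move=> _ [q [p ->]]; exists [:: (q, p)]; rewrite big_seq1.
Qed.

Let TSs0 s : thetas s = 0 -> TSs s = 0.
Proof.
move=> s0; have [_ [Om [_ /F_QPP [t ->] _ Omp]]] := FS [::] [seq x.2 | x <- s].
have Ep x : x \in s ->
    S x.2 = \sum_(y <- t) sigma (psi (tpure x.2 y.2)) ** S y.1.
  move=> xs; rewrite -[in LHS](Omp x.2) ?map_f// fct_sumE (zmor_sum SB).
  by apply: eq_bigr => y _; rewrite /theta_P (rep_Slact rep).
rewrite /TSs (eq_big_seq (fun x =>
    \sum_(y <- t) T (theta_Q x.1 x.2 y.2) ** S y.1)) /=; last first.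
  move=> x xs; rewrite Ep//; elim: (t) => [|y u IH].
    by rewrite !big_nil rmulr0.
  by rewrite !big_cons rmulDr IH rmulA (rep_Tract rep).
rewrite exchange_big /= big1// => y _.
have -> : \sum_(x <- s) T (theta_Q x.1 x.2 y.2) ** S y.1 =
          T (thetas s y.2) ** S y.1.
  rewrite /thetas fct_sumE (zmor_sum TB); elim: (s) => [|x u IH].
    by rewrite !big_nil rmul0r.
  by rewrite !big_cons rmulDl IH.
by rewrite s0 (zmor0 TB) rmul0r.
Qed.

Let TSs_eq s t : thetas s = thetas t -> TSs s = TSs t.
Proof.
move=> st; apply/eqP; rewrite -subr_eq0 -TSsN -TSs_cat; apply/eqP/TSs0.
by rewrite thetas_cat thetasN st subrr.
Qed.

Let theta_comp q p q' p' :
  theta_Q q p \o theta_Q q' p' = theta_Q (theta_Q q p q') p'.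
Proof.
apply/funext => x /=; rewrite /theta_Q -ractM.
have [_ _ psir] := psi_sys.
by rewrite -psir; congr (ract q (psi _)); exact/esym/tract_pure.
Qed.

Let theta_zmod q p : zmod_morphism (theta_Q q p).
Proof.
have pB : zmod_morphism (tpure p : Q -> tensor P Q).
  move=> x y; apply/eqP; rewrite eq_sym subr_eq; apply/eqP.
  by rewrite -tpureDr subrK.
move=> x y; rewrite /theta_Q pB psi_additive.
apply/eqP; rewrite eq_sym subr_eq; apply/eqP.
by rewrite -ractDr subrK.
Qed.

Let TSs_comp s t : exists u, thetas u = thetas s \o thetas t /\
  TSs u = TSs s ** TSs t.
Proof.
exists [seq (theta_Q x.1 x.2 y.1, y.2) | x <- s, y <- t].
split.
  apply/funext => z; rewrite /thetas big_allpairs_dep /= !fct_sumE.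
  apply: eq_bigr => x _; rewrite !fct_sumE.
  rewrite (zmor_sum (theta_zmod _ _)); apply: eq_bigr => y _ /=.
  by rewrite -theta_comp.
rewrite /TSs big_allpairs_dep /=; elim: (s) => [|x u IH].
  by rewrite !big_nil rmul0r.
rewrite !big_cons rmulDl IH; congr (_ + _); elim: (t) => [|y v IHv].
  by rewrite !big_nil rmulr0.
rewrite !big_cons rmulDr IHv; congr (_ + _).
by rewrite (rep_Tract rep) (rep_psi rep) !rmulA.
Qed.

Lemma is_pi_unique pi pi' : is_pi S T pi -> is_pi S T pi' ->
  forall f, F_PQ f -> pi f = pi' f.
Proof.
move=> [piB _ pith] [piB' _ pith'] f.
have F0 : F_PQ 0 by case: (subgroup_span [set f | exists q p, f = theta_Q q p]).
pose I := [set f | F_PQ f /\ pi f = pi' f].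
suff FI : F_PQ `<=` I by move=> /FI[].
apply: smallest_sub; last by move=> _ [q [p ->]]; split;
  [exact: F_PQ_theta | rewrite pith pith'].
split=> [|g h [Fg eg] [Fh eh]].
  by split=> //; rewrite -[0](subrr 0) piB ?piB'// !subrr.
split; last by rewrite piB ?piB' ?eg ?eh.
by case: (subgroup_span [set f | exists q p, f = theta_Q q p]) => _; apply.
Qed.

Lemma pi_TSP : is_pi S T (pi_TS S T).
Proof.
apply: xgetPex.
have [pi piE] : exists pi : (Q -> Q) -> B, forall s, pi (thetas s) = TSs s.
  exists (fun f => xget 0 [set b | exists s, f = thetas s /\ b = TSs s]) => s.
  apply: xget_unique; first by exists s.
  by move=> _ [t [/TSs_eq -> ->]].
exists pi; split=> [f g /F_PQP[s ->] /F_PQP[t ->]|f g /F_PQP[s ->] /F_PQP[t ->]|].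
- rewrite -![\sum_(x <- _) _]/(thetas _) -thetasN -thetas_cat.
  by rewrite !piE TSs_cat TSsN.
- rewrite -![\sum_(x <- _) _]/(thetas _) !piE.
  by have [u [<- <-]] := TSs_comp s t.
- move=> q p; have := piE [:: (q, p)].
  by rewrite /thetas /TSs !big_seq1.
Qed.

End PiTheory.

(* J_(S,T,sigma,B) *)
Definition J_rep (B : rngType) (S : P -> B) (T : Q -> B) (sigma : R -> B)
    : set R :=
  [set r | (pi_TS S T @` F_PQ) (sigma r)].

Definition CP_invariant (J : set R) (B : rngType) (S : P -> B) (T : Q -> B)
    (sigma : R -> B) : Prop :=
  forall x, J x -> pi_TS S T (Delta x) = sigma x.

(* The generators of the ideal T(J) of the Toeplitz ring A. *)
Definition CP_relations (A : rngType) (iP : P -> A) (iQ : Q -> A)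
    (iR : R -> A) (J : set R) : set A :=
  [set iR x - pi_TS iP iQ (Delta x) | x in J].

(* O_(P,Q,psi)(J) = A / T(J), with quotient map rho_J. *)
Definition CP_ring (A : rngType) (iP : P -> A) (iQ : Q -> A)
    (iR : R -> A) (J : set R) : rngType :=
  rng_quot (CP_relations iP iQ iR J).

Definition rho (A : rngType) (iP : P -> A) (iQ : Q -> A)
    (iR : R -> A) (J : set R) : A -> CP_ring iP iQ iR J :=
  @to_quot A (CP_relations iP iQ iR J).

Definition iota_P (A : rngType) (iP : P -> A) (iQ : Q -> A) (iR : R -> A)
    (J : set R) : P -> CP_ring iP iQ iR J := rho iP iQ iR J \o iP.
Definition iota_Q (A : rngType) (iP : P -> A) (iQ : Q -> A) (iR : R -> A)
    (J : set R) : Q -> CP_ring iP iQ iR J := rho iP iQ iR J \o iQ.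
Definition iota_R (A : rngType) (iP : P -> A) (iQ : Q -> A) (iR : R -> A)
    (J : set R) : R -> CP_ring iP iQ iR J := rho iP iQ iR J \o iR.

End Systems.

(* Toeplitz representations exist: take the quotient of the term algebra on
   P, Q, R by the equations that hold under every covariant representation. *)
Section ToeplitzExists.
Variables (R : rngType) (P Q : bimodType R) (psi : tensor P Q -> R).

Inductive tterm : Type :=
| TermP of P | TermQ of Q | TermR of R
| TermZero | TermAdd of tterm & tterm | TermOpp of tterm
| TermMul of tterm & tterm.

HB.instance Definition _ := gen_eqMixin tterm.
HB.instance Definition _ := gen_choiceMixin tterm.

Fixpoint teval (B : rngType) (S : P -> B) (T : Q -> B) (sigma : R -> B)
    (t : tterm) : B :=
  match t with
  | TermP p => S p
  | TermQ q => T q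
  | TermR r => sigma r
  | TermZero => 0
  | TermAdd t u => teval S T sigma t + teval S T sigma u
  | TermOpp t => - teval S T sigma t
  | TermMul t u => teval S T sigma t ** teval S T sigma u
  end.

Definition tterm_eqv (t u : tterm) : Prop :=
  forall (B : rngType) (S : P -> B) (T : Q -> B) (sigma : R -> B),
    covariant_rep psi S T sigma -> teval S T sigma t = teval S T sigma u.

Definition tterm_eqb (t u : tterm) : bool := `[< tterm_eqv t u >].

Fact tterm_eqb_equiv : equiv_class_of tterm_eqb.
Proof.
split=> [s|s t|t s u]; first exact/asboolP.
  by apply/asboolP/asboolP => st B S T sigma rep; rewrite st.
move=> /asboolP st /asboolP tu; apply/asboolP => B S T sigma rep.
by rewrite st ?tu.
Qed.

Canonical tterm_equiv := EquivRelPack tterm_eqb_equiv.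

Definition toeplitz := {eq_quot tterm_eqb}%qT.
HB.instance Definition _ := Choice.on toeplitz.

Definition tz (t : tterm) : toeplitz := (\pi_toeplitz t)%qT.

Lemma tz_eq t u : tz t = tz u <-> tterm_eqv t u.
Proof.
split=> [/eqP|tu]; first by rewrite /tz piE => /asboolP.
by apply/eqP; rewrite /tz piE; apply/asboolP.
Qed.

Lemma tzK x : tz (repr x) = x. Proof. exact: reprK. Qed.

Lemma tz_repr t : tterm_eqv (repr (tz t)) t.
Proof. by apply/tz_eq; rewrite tzK. Qed.

Definition tz_add (x y : toeplitz) := tz (TermAdd (repr x) (repr y)).
Definition tz_opp (x : toeplitz) := tz (TermOpp (repr x)).
Definition tz_mul (x y : toeplitz) := tz (TermMul (repr x) (repr y)).

Lemma tz_addE t u : tz (TermAdd t u) = tz_add (tz t) (tz u).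
Proof. by apply/tz_eq => B S T sigma rep /=; rewrite !tz_repr. Qed.

Lemma tz_oppE t : tz (TermOpp t) = tz_opp (tz t).
Proof. by apply/tz_eq => B S T sigma rep /=; rewrite !tz_repr. Qed.

Lemma tz_mulE t u : tz (TermMul t u) = tz_mul (tz t) (tz u).
Proof. by apply/tz_eq => B S T sigma rep /=; rewrite !tz_repr. Qed.

Fact tz_addA : associative tz_add.
Proof.
move=> x y z; rewrite -[x]tzK -[y]tzK -[z]tzK -!tz_addE.
by apply/tz_eq => B S T sigma rep /=; rewrite addrA.
Qed.

Fact tz_addC : commutative tz_add.
Proof.
move=> x y; rewrite -[x]tzK -[y]tzK -!tz_addE.
by apply/tz_eq => B S T sigma rep /=; rewrite addrC.
Qed.

Fact tz_add0 : left_id (tz TermZero) tz_add.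
Proof.
move=> x; rewrite -[x]tzK -!tz_addE.
by apply/tz_eq => B S T sigma rep /=; rewrite add0r.
Qed.

Fact tz_addN : left_inverse (tz TermZero) tz_opp tz_add.
Proof.
move=> x; rewrite -[x]tzK -tz_oppE -!tz_addE.
by apply/tz_eq => B S T sigma rep /=; rewrite addNr.
Qed.

HB.instance Definition _ := GRing.isZmodule.Build toeplitz
  tz_addA tz_addC tz_add0 tz_addN.

Fact tz_mulA : associative tz_mul.
Proof.
move=> x y z; rewrite -[x]tzK -[y]tzK -[z]tzK -!tz_mulE.
by apply/tz_eq => B S T sigma rep /=; rewrite rmulA.
Qed.

Fact tz_mulDl : left_distributive tz_mul +%R.
Proof.
move=> x y z; rewrite -[x]tzK -[y]tzK -[z]tzK.
rewrite -[tz _ + tz _]tz_addE -!tz_mulE -[RHS]tz_addE.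
by apply/tz_eq => B S T sigma rep /=; rewrite rmulDl.
Qed.

Fact tz_mulDr : right_distributive tz_mul +%R.
Proof.
move=> x y z; rewrite -[x]tzK -[y]tzK -[z]tzK.
rewrite -[tz _ + tz _]tz_addE -!tz_mulE -[RHS]tz_addE.
by apply/tz_eq => B S T sigma rep /=; rewrite rmulDr.
Qed.

HB.instance Definition _ := Zmodule_isRng.Build toeplitz
  tz_mulA tz_mulDl tz_mulDr.

Lemma tzD t u : tz (TermAdd t u) = tz t + tz u. Proof. exact: tz_addE. Qed.
Lemma tzN t : tz (TermOpp t) = - tz t. Proof. exact: tz_oppE. Qed.
Lemma tzM t u : tz (TermMul t u) = tz t ** tz u. Proof. exact: tz_mulE. Qed.

Lemma toeplitz_exists :
  is_toeplitz psi (tz \o TermP) (tz \o TermQ) (tz \o TermR).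
Proof.
split.
- split=> [x y|x y||p r|r p|q r|r q|p q] /=; last first.
  + by rewrite -tzM; apply/tz_eq => B S T sigma []/=.
  + by rewrite -tzM; apply/tz_eq => B S T sigma []/=.
  + by rewrite -tzM; apply/tz_eq => B S T sigma []/=.
  + by rewrite -tzM; apply/tz_eq => B S T sigma []/=.
  + by rewrite -tzM; apply/tz_eq => B S T sigma []/=.
  + split=> x y /=; rewrite -?tzM -?tzN -?tzD.
      by apply/tz_eq => B S T sigma [_ _ [h _]] *; apply: h.
    by apply/tz_eq => B S T sigma [_ _ [_ h]] *; apply: h.
  + by rewrite -?tzM -?tzN -?tzD; apply/tz_eq => B S T sigma []/=.
  + by rewrite -?tzM -?tzN -?tzD; apply/tz_eq => B S T sigma []/=.
- apply/seteqP; split=> // x _; rewrite -[x]tzK.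
  move=> I [[[I0 IB] IM] IG].
  have IN y : I y -> I (- y) by move=> Iy; rewrite -sub0r; apply: IB.
  elim: (repr x) => [p|q|r||t It u Iu|t It|t It u Iu].
  + by apply: IG; right; exists p.
  + by apply: IG; left; right; exists q.
  + by apply: IG; left; left; exists r.
  + exact: I0.
  + by rewrite tzD -[tz u]opprK; apply: IB => //; apply: IN.
  + by rewrite tzN; apply: IN.
  + by rewrite tzM; apply: IM.
- move=> B S T sigma rep.
  pose eta (x : toeplitz) := teval S T sigma (repr x).
  have etaE t : eta (tz t) = teval S T sigma t by apply: tz_repr.
  exists eta; split=> [|eta' [[eB eM] eR eQ eP]].
    split; try by apply/funext => ?; apply: etaE.
    by split=> x y; rewrite -[x]tzK -[y]tzK -?tzN -?tzD -?tzM !etaE.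
  apply/funext => x; rewrite -[x]tzK etaE.
  elim: (repr x) => [p|q|r||t It u Iu|t It|t It u Iu] /=.
  + by rewrite -eP.
  + by rewrite -eQ.
  + by rewrite -eR.
  + by have -> : tz TermZero = 0 by []; rewrite (zmor0 eB).
  + by rewrite tzD (zmorD eB) It Iu.
  + by rewrite tzN (zmorN eB) It.
  + by rewrite tzM eM It Iu.
Qed.

End ToeplitzExists.

(* Main.v *)
(** Parts (1) and (2) follow from the universal property of the Toeplitz ring.
    For the grading of O(J), map it by (2) to "Laurent polynomials" over B,
    via S t^-1, T t, sigma. For the injectivity of iota_R^J and the maximality
    of J, let the Toeplitz ring act on a Fock module with vacuum vector: T(J)
    acts by operators whose values have coefficients in J and bounded level.
    If r acts in this way then r is in J, and each psi(p, r q) acts with a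
    smaller bound; by induction on the bound psi(p, r q) = 0 for all p, q, so
    r is in J and ker Delta, hence zero. Similarly, if r - pi(k) acts in this
    way, its vacuum coefficient r is in J. Conversely, a homogeneous x in the
    kernel of eta is brought to degree 0 by multiplying by S(P) on the left or
    T(Q) on the right, which loses nothing by (FS), and in degree 0 one
    inducts on the length of words via x |-> S(p) x T(q). *)
Require Import Defs.
From mathcomp Require Import all_boot all_order all_algebra.
From mathcomp Require Import boolp classical_sets functions.
From mathcomp Require Import cardinality fsbigop.
From HB Require Import structures.

Set Implicit Arguments.
Unset Strict Implicit.
Unset Printing Implicit Defensive.

Import GRing.Theory.

Local Open Scope classical_set_scope.
Local Open Scope ring_scope.

(** * Additive maps, subgroups and generated subrings *)

Lemma zmod_morphism_comp (U V W : zmodType) (f : U -> V) (g : V -> W) :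
  zmod_morphism f -> zmod_morphism g -> zmod_morphism (g \o f).
Proof. by move=> fB gB x y; rewrite /= fB gB. Qed.

Lemma rng_hom_comp (A B C : rngType) (f : A -> B) (g : B -> C) :
  rng_hom f -> rng_hom g -> rng_hom (g \o f).
Proof.
move=> [fB fM] [gB gM]; split; first exact: zmod_morphism_comp.
by move=> x y; rewrite /= fM gM.
Qed.

Lemma subgroupN (A : zmodType) (H : set A) x : subgroup H -> H x -> H (- x).
Proof. by move=> [H0 HB] Hx; rewrite -sub0r; apply: HB. Qed.

Lemma subgroupD (A : zmodType) (H : set A) x y :
  subgroup H -> H x -> H y -> H (x + y).
Proof.
move=> Hs Hx Hy; rewrite -[y]opprK; have [_ HB] := Hs.
by apply: HB => //; apply: subgroupN.
Qed.

Lemma subgroup_mulrz (A : zmodType) (H : set A) x (n : int) :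
  subgroup H -> H x -> H (x *~ n).
Proof.
move=> Hs Hx; have Hn k : H (x *+ k).
  elim: k => [|k IH]; first by rewrite mulr0n; case: Hs.
  by rewrite mulrS; apply: subgroupD.
by case: n => n; [exact: Hn | rewrite NegzE mulrNz; apply: subgroupN (Hn _)].
Qed.

Lemma subgroup_preimage (A B : zmodType) (f : A -> B) (H : set B) :
  zmod_morphism f -> subgroup H -> subgroup (f @^-1` H).
Proof.
move=> fB [H0 HB]; split=> [|x y]; rewrite /= ?(zmor0 fB) // fB.
exact: HB.
Qed.

Lemma rmul_zmodl (A : rngType) (a : A) : zmod_morphism (fun x => a ** x).
Proof. by move=> x y; rewrite rmulBr. Qed.

Lemma rmul_zmodr (A : rngType) (a : A) : zmod_morphism (fun x => x ** a).
Proof. by move=> x y; rewrite rmulBl. Qed.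

Lemma span_sub (A : zmodType) (G H : set A) :
  subgroup H -> G `<=` H -> additive_span G `<=` H.
Proof. exact: smallest_sub. Qed.

Lemma span_gen (A : zmodType) (G : set A) : G `<=` additive_span G.
Proof. exact: sub_gen_smallest. Qed.

Lemma rng_span_ind (A : rngType) (G H : set A) :
  rng_span G = [set: A] -> subrng H -> G `<=` H -> forall x, H x.
Proof.
move=> GT Hs GH x; have : rng_span G x by rewrite GT.
exact: (smallest_sub Hs GH).
Qed.

Lemma rng_span_hom (A B : rngType) (G : set A) (f : A -> B) :
  rng_hom f -> rng_span G = [set: A] -> (forall b, exists a, f a = b) ->
  rng_span (f @` G) = [set: B].
Proof.
move=> [fB fM] GT fs; apply/seteqP; split=> // b _; have [a <-] := fs b.
move=> H [Hs HG]; move: a.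
apply: (@rng_span_ind _ G (f @^-1` H)) => //; last first.
  by move=> a Ga; apply: HG; exists a.
case: Hs => Hs HM; split; first exact: subgroup_preimage.
by move=> x y; rewrite /= fM; apply: HM.
Qed.

Lemma rng_hom_ext (A B : rngType) (G : set A) (f g : A -> B) :
  rng_span G = [set: A] -> rng_hom f -> rng_hom g ->
  (forall x, G x -> f x = g x) -> f = g.
Proof.
move=> GT [fB fM] [gB gM] fg; apply/funext.
apply: (@rng_span_ind _ G [set x | f x = g x]) => //.
split; last by move=> x y /= ex ey; rewrite fM gM ex ey.
split=> [|x y /= ex ey]; first by rewrite /= (zmor0 fB) (zmor0 gB).
by rewrite fB gB ex ey.
Qed.

(** Multiplication is additive in each factor, so closure need only be tested on two generators. *)
Lemma rng_span_mul (A : rngType) (G : set A) :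
  (forall x y, G x -> G y -> additive_span G (x ** y)) ->
  subrng (additive_span G).
Proof.
have Hs := subgroup_span G.
move=> GM; split=> // x y Gx Gy; move: x Gx.
apply: (span_sub (H := [set x | additive_span G (x ** y)])).
  exact: (subgroup_preimage (@rmul_zmodr _ y)).
move=> x Gx; move: y Gy => /=.
apply: (span_sub (H := [set y | additive_span G (x ** y)])).
  exact: (subgroup_preimage (@rmul_zmodl _ x)).
by move=> y Gy; apply: GM.
Qed.

(** * The ring of additive endomorphisms of an abelian group *)

Section Endomorphisms.
Variable V : zmodType.

(** Both concrete representations below, on the Fock module and on Laurent sequences, take values in
    such a ring. *)
Record endo := Endo { endo_fun :> V -> V; endoB : zmod_morphism endo_fun }.

Lemma endoP (f g : endo) : (forall x, f x = g x) -> f = g.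
Proof.
case: f g => [f fB] [g gB] /= /funext fg; case: g / fg gB => gB.
by congr Endo; apply: Prop_irrelevance.
Qed.

HB.instance Definition _ := gen_eqMixin endo.
HB.instance Definition _ := gen_choiceMixin endo.

Fact endo0_subproof : zmod_morphism (fun _ : V => 0 : V).
Proof. by move=> x y; rewrite subrr. Qed.
Fact endo_add_subproof (f g : endo) : zmod_morphism (fun x => f x + g x).
Proof. by move=> x y; rewrite !endoB opprD addrACA. Qed.
Fact endo_opp_subproof (f : endo) : zmod_morphism (fun x => - f x).
Proof. by move=> x y; rewrite !endoB opprD. Qed.
Fact endo_mul_subproof (f g : endo) : zmod_morphism (fun x => f (g x)).
Proof. by move=> x y; rewrite !endoB. Qed.

Definition endo0 := Endo endo0_subproof.
Definition endo_add f g := Endo (endo_add_subproof f g).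
Definition endo_opp f := Endo (endo_opp_subproof f).
Definition endo_mul f g := Endo (endo_mul_subproof f g).

Fact endo_addA : associative endo_add.
Proof. by move=> f g h; apply: endoP => x /=; rewrite addrA. Qed.
Fact endo_addC : commutative endo_add.
Proof. by move=> f g; apply: endoP => x /=; rewrite addrC. Qed.
Fact endo_add0 : left_id endo0 endo_add.
Proof. by move=> f; apply: endoP => x /=; rewrite add0r. Qed.
Fact endo_addN : left_inverse endo0 endo_opp endo_add.
Proof. by move=> f; apply: endoP => x /=; rewrite addNr. Qed.

HB.instance Definition _ := GRing.isZmodule.Build endo
  endo_addA endo_addC endo_add0 endo_addN.

Fact endo_mulA : associative endo_mul.
Proof. by move=> f g h; apply: endoP. Qed.
Fact endo_mulDl : left_distributive endo_mul +%R.
Proof. by move=> f g h; apply: endoP. Qed.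
Fact endo_mulDr : right_distributive endo_mul +%R.
Proof. by move=> f g h; apply: endoP => x /=; rewrite (zmorD (endoB f)). Qed.

HB.instance Definition _ := Zmodule_isRng.Build endo
  endo_mulA endo_mulDl endo_mulDr.

Lemma endoBE (f g : endo) x : (f - g) x = f x - g x. Proof. by []. Qed.
Lemma endo_sumE I (s : seq I) (F : I -> endo) x :
  (\sum_(i <- s) F i) x = \sum_(i <- s) F i x.
Proof. by elim: s => [|i s IH]; rewrite ?big_nil ?big_cons //= IH. Qed.

End Endomorphisms.

(* B need not act faithfully on itself, but it does on its unitization B + Z. *)
Section Dorroh.
Variable B : rngType.
Implicit Types (b c : B) (x y : B * int).

(** Left multiplication by [(b, 0)] in the unitization. *)
Definition dact b x : B * int := (b ** x.1 + b *~ x.2, 0).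

Lemma dactBr b : zmod_morphism (dact b).
Proof.
move=> [x m] [y n]; congr pair => /=.
by rewrite rmulBr mulrzBr opprD addrACA.
Qed.

Lemma dactBl x : zmod_morphism (dact^~ x).
Proof.
move=> b c; congr pair => /=.
by rewrite rmulBl mulrzBl opprD addrACA.
Qed.

Lemma dactM b c x : dact (b ** c) x = dact b (dact c x).
Proof.
rewrite /dact /= mulr0z addr0 rmulDr rmulA; congr (_ + _, _).
case: x => _ n /=; case: n => n.
  elim: n => [|n IH]; first by rewrite !mulr0z rmulr0.
  by rewrite -!pmulrn !mulrS rmulDr !pmulrn IH.
rewrite !NegzE !mulrNz rmulrN; congr (- _).
elim: (n.+1) => [|k IH]; first by rewrite !mulr0z rmulr0.
by rewrite -!pmulrn !mulrS rmulDr !pmulrn IH.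
Qed.

Lemma dact1 b : dact b (0, 1) = (b, 0).
Proof. by rewrite /dact /= rmulr0 add0r mulr1z. Qed.

End Dorroh.

(** * Finitely supported families indexed by the integers *)

Section FiniteSums.
Variable B : zmodType.
Implicit Types d : int -> B.

Lemma fsum_seqE d (s : seq int) : uniq s -> (forall n, n \notin s -> d n = 0) ->
  \sum_(n \in [set: int]) d n = \sum_(n <- s) d n.
Proof.
move=> us ds; rewrite (fsbigE s) //=; last by move=> n _; apply: ds.
by apply: eq_bigl => n; rewrite in_setT.
Qed.

Lemma finite_support_seq d : finite_set [set n | d n != 0] ->
  exists2 s : seq int, uniq s & forall n, n \notin s -> d n = 0.
Proof.
move=> /finite_seqP[s ds]; exists (undup s); first exact: undup_uniq.
move=> n; rewrite mem_undup => ns; apply/eqP; apply: contraNT ns => dn.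
by have : [set n | d n != 0] n by []; rewrite ds.
Qed.

(** Sums of such families form a subgroup: two supports lie in a common finite list, over which
    differences are taken termwise. *)
Lemma span_bigcup_fsum (G : int -> set B) : (forall n, subgroup (G n)) ->
  forall b, additive_span (\bigcup_n G n) b ->
    exists d, [/\ forall n, G n (d n), finite_set [set n | d n != 0]
      & b = \sum_(n \in [set: int]) d n].
Proof.
move=> Gs; apply: span_sub; last first.
  move=> b [n _ Gb]; exists (fun k => if k == n then b else 0); split.
  - by move=> k; case: eqP => [->//|_]; case: (Gs k).
  - apply: (@sub_finite_set _ _ [set n]); last exact: finite_set1.
    by move=> k /=; case: (k =P n) => // _; rewrite eqxx.
  - rewrite (@fsum_seqE _ [:: n]) //; first by rewrite big_seq1 /= eqxx.
    by move=> k; rewrite inE => /negbTE ->.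
split=> [|x y [d [Gd fd ->]] [d' [Gd' fd' ->]]].
  exists (fun=> 0); split.
  - by move=> n; case: (Gs n).
  - by apply: (@sub_finite_set _ _ set0) => // n /=; rewrite eqxx.
  - by rewrite fsbig1.
exists (fun n => d n - d' n); split.
- by move=> n; case: (Gs n) => _; apply.
- have [s us ds] := finite_support_seq fd.
  have [t ut dt] := finite_support_seq fd'.
  apply/finite_seqP.
  exists [seq n <- s ++ t | d n - d' n != 0].
  apply/seteqP; split=> n /=; rewrite mem_filter; last by case/andP.
  move=> h; rewrite h mem_cat; apply: contraNT h.
  by rewrite negb_or => /andP[/ds -> /dt ->]; rewrite subr0.
have [s us ds] := finite_support_seq fd.
have [t ut dt] := finite_support_seq fd'.
have dst n : n \notin undup (s ++ t) -> d n = 0 /\ d' n = 0.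
  by rewrite mem_undup mem_cat negb_or => /andP[/ds -> /dt ->].
rewrite !(@fsum_seqE _ (undup (s ++ t))) ?undup_uniq //.
- by rewrite -sumrB.
- by move=> n /dst[-> ->]; rewrite subr0.
- by move=> n /dst[].
- by move=> n /dst[].
Qed.

End FiniteSums.

(** * Covariant representations, the map pi and local units *)

Section Representations.
Variables (R : rngType) (P Q : bimodType R) (psi : tensor P Q -> R).

Lemma covariant_rep_hom (A B : rngType) (S : P -> A) (T : Q -> A)
    (sigma : R -> A) (f : A -> B) :
  rng_hom f -> covariant_rep psi S T sigma ->
  covariant_rep psi (f \o S) (f \o T) (f \o sigma).
Proof.
move=> fh; have [fB fM] := fh.
case=> SB TB sh Sr Sl Tr Tl sp; split; try exact: zmod_morphism_comp.
- exact: rng_hom_comp.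
- by move=> p r; rewrite /= Sr fM.
- by move=> r p; rewrite /= Sl fM.
- by move=> q r; rewrite /= Tr fM.
- by move=> r q; rewrite /= Tl fM.
- by move=> p q; rewrite /= sp fM.
Qed.

Hypotheses (psi_sys : is_system psi) (FS : cond_FS psi).

(** Both sides send theta_{q,p} to [f (T q) ** f (S p)], and pi is determined on F_P(Q) by these
    values. *)
Lemma pi_TS_hom (A B : rngType) (S : P -> A) (T : Q -> A) (sigma : R -> A)
    (f : A -> B) :
  rng_hom f -> covariant_rep psi S T sigma ->
  forall k, F_PQ psi k -> f (pi_TS psi S T k) = pi_TS psi (f \o S) (f \o T) k.
Proof.
move=> fh rep k Fk; have [fB fM] := fh.
have [piB piM pith] := pi_TSP psi_sys FS rep.
have pi' := pi_TSP psi_sys FS (covariant_rep_hom fh rep).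
suff pif : is_pi psi (f \o S) (f \o T) (f \o pi_TS psi S T).
  exact: (is_pi_unique pif pi').
split=> [g h Fg Fh|g h Fg Fh|q p] /=.
- by rewrite piB.
- by rewrite piM.
- by rewrite pith fM.
Qed.

Section PiSum.
Variables (B : rngType) (S : P -> B) (T : Q -> B) (sigma : R -> B).
Hypothesis rep : covariant_rep psi S T sigma.

Lemma pi_TSB f g : F_PQ psi f -> F_PQ psi g ->
  pi_TS psi S T (f - g) = pi_TS psi S T f - pi_TS psi S T g.
Proof. by have [h _ _] := pi_TSP psi_sys FS rep; apply: h. Qed.

Lemma pi_TS_theta q p : pi_TS psi S T (theta_Q psi q p) = T q ** S p.
Proof. by have [_ _ h] := pi_TSP psi_sys FS rep. Qed.

Lemma F_PQ_subgroup : subgroup (F_PQ psi).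
Proof. exact: subgroup_span. Qed.

(** The induction carries membership in F_P(Q) along, because additivity of pi is known only
    there. *)
Lemma pi_TS_ind (H : set B) : subgroup H -> (forall q p, H (T q ** S p)) ->
  forall k, F_PQ psi k -> H (pi_TS psi S T k).
Proof.
move=> [H0 HB] Hth k Fk; have [F0 FB] := F_PQ_subgroup.
suff [] : F_PQ psi k /\ H (pi_TS psi S T k) by [].
move: k Fk; apply: span_sub; last first.
  by move=> _ [q [p ->]]; rewrite pi_TS_theta; split => //; apply: F_PQ_theta.
split=> [|f g [Ff Hf] [Fg Hg]].
  split=> //; rewrite -(subrr (0 : Q -> Q)) pi_TSB // subrr.
  by [].
by split; [apply: FB | rewrite pi_TSB //; apply: HB].
Qed.

Lemma span_pi_TS b : additive_span [set b | exists q p, b = T q ** S p] b ->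
  exists2 k, F_PQ psi k & pi_TS psi S T k = b.
Proof.
have [F0 FB] := F_PQ_subgroup; move: b; apply: span_sub; last first.
  move=> _ [q [p ->]]; exists (theta_Q psi q p); first exact: F_PQ_theta.
  exact: pi_TS_theta.
split=> [|x y [f Ff <-] [g Fg <-]].
  by exists 0 => //; rewrite -(subrr (0 : Q -> Q)) pi_TSB // subrr.
by exists (f - g); [apply: FB | rewrite pi_TSB].
Qed.

(** On a generator, T(q) S(p) T(x) = T(q) sigma(psi(p, x)) = T(theta_{q,p}(x)). *)
Lemma pi_TS_T k : F_PQ psi k -> forall x, pi_TS psi S T k ** T x = T (k x).
Proof.
have TB := rep_T rep; have [F0 FB] := F_PQ_subgroup.
move=> Fk; suff [] : F_PQ psi k /\ forall x, pi_TS psi S T k ** T x = T (k x).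
  by [].
move: k Fk; apply: span_sub; last first.
  move=> _ [q [p ->]]; split; first exact: F_PQ_theta.
  move=> x; rewrite pi_TS_theta -rmulA -(rep_psi rep) /theta_Q.
  by rewrite (rep_Tract rep).
split=> [|f g [Ff Hf] [Fg Hg]].
  split=> // x; rewrite -(subrr (0 : Q -> Q)) pi_TSB // !subrr rmul0r.
  by rewrite -(zmor0 TB).
split=> [|x]; first exact: FB.
by rewrite pi_TSB // rmulBl Hf Hg -TB.
Qed.

Lemma left_units (qs : seq Q) : exists2 k, F_PQ psi k &
  {in qs, forall q, pi_TS psi S T k ** T q = T q}.
Proof.
have [k [_ [Fk _ kq _]]] := FS qs [::].
by exists k => // q qqs; rewrite pi_TS_T // kq.
Qed.

(** Condition (FS) gives Omega acting on P, while a unit in the image of F_P(Q) is wanted. Since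
    S(p') T(q) S(p) = S(theta_{p,q}(p')), replacing each theta_{p,q} in Omega by T(q) S(p) gives e
    with S(p) e = S(Omega(p)). *)
Lemma right_units (ps : seq P) : exists2 k, F_PQ psi k &
  {in ps, forall p, S p ** pi_TS psi S T k = S p}.
Proof.
have SB := rep_S rep.
have [_ [om [_ Fom _ omp]]] := FS [::] ps.
suff [e [He ep]] : exists e,
    additive_span [set b | exists q p, b = T q ** S p] e /\
    forall p, S p ** e = S (om p).
  have [k Fk ke] := span_pi_TS He.
  by exists k => // p pps; rewrite ke ep omp.
have [G0 GB] := subgroup_span [set b | exists q p, b = T q ** S p].
move: om Fom {omp}; apply: span_sub; last first.
  move=> _ [p [q ->]]; exists (T q ** S p); split.
    by apply: span_gen; exists q, p.
  by move=> p'; rewrite rmulA -(rep_psi rep) -(rep_Slact rep).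
split=> [|f g [e [He ef]] [e' [He' eg]]].
  by exists 0; split=> // p; rewrite rmulr0 -(zmor0 SB).
exists (e - e'); split; first exact: GB.
by move=> p; rewrite rmulBr ef eg -SB.
Qed.

(* S(p) (sigma x - pi (Delta x)) lies in S(P) and is killed by T(Q), hence by
   right units. *)
Lemma S_relation x p : F_PQ psi (Delta x) ->
  S p ** (sigma x - pi_TS psi S T (Delta x)) = 0.
Proof.
have SB := rep_S rep; have Ss : subgroup (range S).
  split=> [|_ _ [y _ <-] [z _ <-]]; first by exists 0 => //; rewrite (zmor0 SB).
  by exists (y - z) => //; rewrite SB.
move=> Fx; have : range S (S p ** (sigma x - pi_TS psi S T (Delta x))).
  rewrite rmulBr -(rep_Sract rep); apply: Ss.2; first by exists (ract p x).
  move: (Delta x) Fx; apply: (pi_TS_ind (H := [set b | range S (S p ** b)])).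
    exact: (subgroup_preimage (@rmul_zmodl _ (S p)) Ss).
  move=> q p' /=; rewrite rmulA -(rep_psi rep) -(rep_Slact rep).
  by exists (lact (psi (tpure p q)) p').
move=> [p' _ e]; rewrite -e.
have p'0 q : S p' ** T q = 0.
  by rewrite e -rmulA rmulBl (pi_TS_T Fx) -(rep_Tlact rep) subrr rmulr0.
have [k Fk Sk] := right_units [:: p']; rewrite -(Sk p') ?mem_head //.
move: k Fk {Sk}; apply: (pi_TS_ind (H := [set b | S p' ** b = 0])).
  apply: (subgroup_preimage (@rmul_zmodl _ (S p')) (H := [set 0])).
  by split=> // _ _ -> ->; rewrite subrr.
by move=> q p'' /=; rewrite rmulA p'0 rmul0r.
Qed.

End PiSum.

(** By (FS), q is a finite sum of terms q_i psi(p_i, q). *)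
Lemma psi_nondegenerate q : (forall p, psi (tpure p q) = 0) -> q = 0.
Proof.
move=> h; have [k [_ [Fk _ kq _]]] := FS [:: q] [::].
rewrite -(kq q) ?mem_head //.
have [s ->] := F_PQP Fk; rewrite fct_sumE big1 // => x _.
by rewrite /theta_Q h ractr0.
Qed.

End Representations.

(** * The Fock representation *)

(* A Fock-type representation coinduced from the unitization of R: it acts on
   the functions f from words in P to R + Z that are additive and left R-linear
   in every letter.  Coinduction replaces the tensor powers of Q by maps from
   P^n, so that no tensor products are needed. *)
Section Fock.
Variables (R : rngType) (P Q : bimodType R) (psi : tensor P Q -> R).
Implicit Types (f : seq P -> R * int) (r : R) (p : P) (q : Q) (s : seq P).

(** The left action on Hom(P, M), (r f)(p) = f(p r); on the empty word R acts on its unitization. *)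
Definition word_act r f s : R * int :=
  if s is p :: s' then f (ract p r :: s') else dact r (f [::]).

(** For consecutive letters this says f(.. r p, p' ..) = f(.. p, p' r ..), and from the last letter
    the scalar comes out on the left. Reading words backwards, these are families of left R-linear
    maps on the tensor powers of P. *)
Definition word_linear f : Prop :=
  forall u, (forall s, zmod_morphism (fun p => f (u ++ p :: s))) /\
    (forall r p s,
       f (u ++ lact r p :: s) = word_act r (fun t => f (u ++ p :: t)) s).

Lemma word_actB r : zmod_morphism (word_act r).
Proof. by move=> f g; apply/funext => -[|p s] //=; exact: dactBr. Qed.

Lemma word_act_zmod f s :
  word_linear f -> zmod_morphism (fun r => word_act r f s).
Proof.
move=> fl x y; case: s => [|p s] /=; first exact: dactBl.
rewrite -((fl [::]).1 s) /=; congr (f (_ :: _)).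
apply/eqP; rewrite eq_sym subr_eq; apply/eqP.
by rewrite -ractDr subrK.
Qed.

Lemma word_actM r r' f s :
  word_act (r ** r') f s = word_act r (word_act r' f) s.
Proof. by case: s => [|p s] /=; rewrite ?dactM ?ractM. Qed.

Lemma word_linear_shift f p :
  word_linear f -> word_linear (fun s => f (p :: s)).
Proof. by move=> fl u; apply: (fl (p :: u)). Qed.

Lemma word_linear_act r f : word_linear f -> word_linear (word_act r f).
Proof.
move=> fl [|p u]; split.
- move=> s p p' /=; rewrite -((fl [::]).1 s) /=; congr (f (_ :: _)).
  by rewrite ractDl ractNr.
- by move=> r' p s; rewrite /= lractA; have [_ /= ->] := fl [::].
- by move=> s; have [h _] := fl (ract p r :: u); apply: h.
- by move=> r' p' s; have [_ h] := fl (ract p r :: u); apply: h.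
Qed.

(** Creation by [q], viewed as the map p |-> psi(p, q): the first letter yields a scalar, which acts
    on f at the remaining word. The value 0 at the empty word leaves no vacuum component. *)
Definition word_create q f s : R * int :=
  if s is p :: s' then word_act (psi (tpure p q)) f s' else 0.

Hypothesis psi_sys : is_system psi.

Lemma psi_zmodl q : zmod_morphism (fun p => psi (tpure p q)).
Proof.
have [psiB _ _] := psi_sys; move=> p p'; rewrite -psiB; congr psi.
by apply/eqP; rewrite eq_sym subr_eq -tpureDl subrK.
Qed.

Lemma psi_zmodr p : zmod_morphism (fun q => psi (tpure p q)).
Proof.
have [psiB _ _] := psi_sys; move=> q q'; rewrite -psiB; congr psi.
by apply/eqP; rewrite eq_sym subr_eq -tpureDr subrK.
Qed.

Lemma psi_lact r p q : psi (tpure (lact r p) q) = r ** psi (tpure p q).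
Proof.
have [_ psil _] := psi_sys; rewrite -psil; congr psi; exact/esym/tlact_pure.
Qed.

Lemma psi_ract r p q : psi (tpure p (ract q r)) = psi (tpure p q) ** r.
Proof.
have [_ _ psir] := psi_sys; rewrite -psir; congr psi; exact/esym/tract_pure.
Qed.

Lemma word_linear_create q f : word_linear f -> word_linear (word_create q f).
Proof.
move=> fl [|p u]; split.
- by move=> s p p' /=; rewrite psi_zmodl (word_act_zmod _ fl).
- move=> r p s /=; rewrite psi_lact word_actM.
  by case: s.
- by move=> s; have [h _] := word_linear_act (psi (tpure p q)) fl u; apply: h.
- move=> r p' s.
  by have [_ h] := word_linear_act (psi (tpure p q)) fl u; apply: h.
Qed.

Definition word_linear_pred : {pred seq P -> R * int} :=
  fun f => `[< word_linear f >].

Fact word_linear_closed : zmod_closed word_linear_pred.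
Proof.
split=> [|f g /asboolP fl /asboolP gl]; apply/asboolP => u; split.
- by move=> s x y; rewrite subr0.
- by move=> r p [|p' s] //=; rewrite /dact /= rmulr0 mulr0z addr0.
- move=> s x y; rewrite -![(f - g) _]/(f _ - g _) ((fl u).1 s) ((gl u).1 s).
  by rewrite opprD addrACA [in RHS]opprD.
- move=> r p s; rewrite -![(f - g) _]/(f _ - g _) ((fl u).2 r) ((gl u).2 r).
  exact/esym/(congr1 (@^~ s) (word_actB r (fun t => f (u ++ p :: t))
    (fun t => g (u ++ p :: t)))).
Qed.

HB.instance Definition _ := GRing.isZmodClosed.Build (seq P -> R * int)
  word_linear_pred word_linear_closed.

Record fock := Fock { fock_val : seq P -> R * int;
  fock_valP : fock_val \in word_linear_pred }.

HB.instance Definition _ := [isSub for fock_val].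
HB.instance Definition _ := [Choice of fock by <:].
HB.instance Definition _ := [SubChoice_isSubZmodule of fock by <:].

End Fock.

(** * The operators on the Fock module *)

Section FockRepresentation.
Variables (R : rngType) (P Q : bimodType R) (psi : tensor P Q -> R).
Hypothesis psi_sys : is_system psi.
Local Notation F := (fock P).

Lemma fock_linear (f : F) : word_linear (fock_val f).
Proof. exact/asboolP/fock_valP. Qed.

Definition mk_fock (f : seq P -> R * int) (fl : word_linear f) : F :=
  Fock (asboolT fl).

Lemma fock_eq (f g : F) : (forall s, fock_val f s = fock_val g s) -> f = g.
Proof. by move=> fg; apply/val_inj/funext. Qed.

Lemma fock_valB (f g : F) s : fock_val (f - g) s = fock_val f s - fock_val g s.
Proof. by []. Qed.

Definition fock_S_fun (p : P) (f : F) : F :=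
  mk_fock (word_linear_shift p (fock_linear f)).
Definition fock_R_fun (r : R) (f : F) : F :=
  mk_fock (word_linear_act r (fock_linear f)).
Definition fock_T_fun (q : Q) (f : F) : F :=
  mk_fock (word_linear_create psi_sys q (fock_linear f)).

Fact fock_S_zmod p : zmod_morphism (fock_S_fun p).
Proof. by move=> f g; apply: fock_eq. Qed.
Fact fock_R_zmod r : zmod_morphism (fock_R_fun r).
Proof.
by move=> f g; apply: fock_eq => s; rewrite /= word_actB.
Qed.
Fact fock_T_zmod q : zmod_morphism (fock_T_fun q).
Proof.
move=> f g; apply: fock_eq => -[|p s]; rewrite fock_valB /= ?subr0 //.
by rewrite word_actB.
Qed.

Definition fock_S p : endo F := Endo (fock_S_zmod p).
Definition fock_T q : endo F := Endo (fock_T_zmod q).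
Definition fock_R r : endo F := Endo (fock_R_zmod r).

Lemma word_act_create (f : F) r q s :
  word_act r (word_create psi q (fock_val f)) s =
  word_create psi (lact r q) (fock_val f) s.
Proof.
case: s => [|p s] /=; first by rewrite /dact /= rmulr0 mulr0z addr0.
by rewrite tpure_balanced.
Qed.

(** S(p) puts [p] in front of the word, which is just the letter that the creation T(q) pairs with
    q; hence S(p) T(q) = psi(p, q) by computation. *)
Lemma fock_rep : covariant_rep psi fock_S fock_T fock_R.
Proof.
split.
- move=> p p'; apply: endoP => f; apply: fock_eq => s.
  exact: ((fock_linear f [::]).1 s).
- move=> q q'; apply: endoP => f; apply: fock_eq => -[|p s].
    by rewrite -[RHS]/(0 - 0) subr0.
  rewrite /= psi_zmodr //; exact: (word_act_zmod s (fock_linear f)).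
- split=> r r'; apply: endoP => f; apply: fock_eq => s.
    exact: (word_act_zmod s (fock_linear f)).
  exact: word_actM.
- by move=> p r; apply: endoP => f; apply: fock_eq.
- move=> r p; apply: endoP => f; apply: fock_eq => s.
  exact: ((fock_linear f [::]).2 r p s).
- move=> q r; apply: endoP => f; apply: fock_eq => -[|p s] //.
  by rewrite /= psi_ract // word_actM.
- move=> r q; apply: endoP => f; apply: fock_eq => s.
  by rewrite /= word_act_create.
- by move=> p q; apply: endoP => f; apply: fock_eq.
Qed.

(** The unit of R + Z at the empty word, from which the coefficient of a scalar operator can be read
    off. *)
Fact vacuum_linear :
  word_linear (fun s : seq P => if s is [::] then (0, 1) else 0 : R * int).
Proof.
move=> u; split=> [s x y|r p s]; first by case: u => [|? ?]; rewrite /= subr0.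
by case: u => [|? ?] /=; case: s => [|? ?] //=;
  rewrite /dact /= rmulr0 mulr0z addr0.
Qed.

Definition vacuum : F := mk_fock vacuum_linear.

Lemma fock_R_vacuum r : fock_val (fock_R r vacuum) [::] = (r, 0).
Proof. exact: dact1. Qed.

(** * Vectors of bounded level with coefficients in J *)

Section IdealLevel.
Variable J : set R.
Hypothesis J_ideal : two_sided_ideal J.

(** At [n = 0] only the zero vector is left, which starts the induction in [fock_K_R0]. *)
Definition fock_J (n : nat) : set F := [set f |
  (forall s, exists2 x, J x & fock_val f s = (x, 0)) /\
  (forall s, (n <= size s)%N -> fock_val f s = 0)].

Lemma fock_J_subgroup n : subgroup (fock_J n).
Proof.
have [[J0 JB] _] := J_ideal.
split; first by split=> s //; exists 0.
move=> f g [fJ f0] [gJ g0]; split=> s.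
  have [x Jx fx] := fJ s; have [y Jy gy] := gJ s.
  exists (x - y); first exact: JB.
  rewrite fock_valB fx gy; congr pair.
by move=> ns; rewrite fock_valB f0 // g0 // subr0.
Qed.

Lemma fock_J_leq m n : (m <= n)%N -> fock_J m `<=` fock_J n.
Proof.
by move=> mn f [fJ f0]; split=> // s ns; apply: f0; apply: leq_trans ns.
Qed.

(** Putting [p] in front lengthens a word by one, so the bound on the level drops by one. *)
Lemma fock_J_S p n f : fock_J n.+1 f -> fock_J n (fock_S p f).
Proof.
by move=> [fJ f0]; split=> s; [apply: fJ | move=> ns; apply: f0].
Qed.

Lemma fock_J_R r n f : fock_J n f -> fock_J n (fock_R r f).
Proof.
have [[J0 _] JM] := J_ideal.
move=> [fJ f0]; split=> -[|p s] /=.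
- have [x Jx fx] := fJ [::]; exists (r ** x); first exact: (JM _ _ Jx).1.
  by rewrite fx /dact /= mulr0z addr0.
- exact: fJ.
- by move=> ns; rewrite f0 // /dact /= rmulr0 mulr0z addr0.
- by move=> ns; apply: f0.
Qed.

Lemma fock_J_T q n f : fock_J n f -> fock_J n.+1 (fock_T q f).
Proof.
have [[J0 _] JM] := J_ideal; move=> fJ.
split=> -[|p s] //=; first by exists 0.
  by have [h _] := fock_J_R (psi (tpure p q)) fJ; apply: h.
by move=> ns; have [_ h] := fock_J_R (psi (tpure p q)) fJ; apply: h.
Qed.

(* The bound n must be uniform in f: fock_K_R0 is an induction on it. *)
Definition fock_K : set (endo F) :=
  [set a | exists n, forall f, fock_J n (a f)].

Lemma fock_K_subgroup : subgroup fock_K.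
Proof.
split.
  by exists 0%N => f; apply: (fock_J_subgroup 0).1.
move=> a b [m ha] [n hb]; exists (maxn m n) => f.
apply: (fock_J_subgroup _).2.
  exact: (fock_J_leq (leq_maxl m n)).
exact: (fock_J_leq (leq_maxr m n)).
Qed.

Lemma fock_K_mulr a b : fock_K a -> fock_K (a ** b).
Proof. by move=> [n ha]; exists n => f; apply: ha. Qed.

(* The whole Toeplitz ring acts by such operators, so that fock_K pulls back to
   a two-sided ideal of it. *)
Definition fock_bounded : set (endo F) :=
  [set b | exists d, forall n f, fock_J n f -> fock_J (d + n) (b f)].

Lemma fock_bounded_subrng : subrng fock_bounded.
Proof.
split; first split.
- by exists 0%N => n f _; apply: (fock_J_subgroup _).1.
- move=> a b [d ha] [e hb]; exists (maxn d e) => n f fJ.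
  apply: (fock_J_subgroup _).2.
    by apply: (fock_J_leq _ (ha _ _ fJ)); rewrite leq_add2r leq_maxl.
  by apply: (fock_J_leq _ (hb _ _ fJ)); rewrite leq_add2r leq_maxr.
- move=> a b [d ha] [e hb]; exists (d + e)%N => n f fJ.
  by rewrite -addnA; apply: ha; apply: hb.
Qed.

Lemma fock_bounded_gen :
  range fock_R `|` range fock_T `|` range fock_S `<=` fock_bounded.
Proof.
move=> _ [[[r _ <-]|[q _ <-]]|[p _ <-]].
- by exists 0%N => n f; apply: fock_J_R.
- by exists 1%N => n f; apply: fock_J_T.
- by exists 0%N => n f fJ; apply: fock_J_S; apply: (fock_J_leq (leqnSn n)).
Qed.

Lemma fock_K_mull a b : fock_bounded a -> fock_K b -> fock_K (a ** b).
Proof. by move=> [d ha] [n hb]; exists (d + n)%N => f; apply: ha. Qed.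

Lemma fock_K_R_J r : fock_K (fock_R r) -> J r.
Proof.
move=> [n /(_ vacuum)[/(_ [::])[x Jx]]] + _; rewrite fock_R_vacuum.
by case=> ->.
Qed.

Hypothesis FS : cond_FS psi.
Hypothesis J_ker : J `&` @Delta R Q @^-1` [set 0] = [set 0].

Lemma fock_K_R0 r : fock_K (fock_R r) -> r = 0.
Proof.
have [SB TB [RB RM] Sr Sl Tr Tl ST] := fock_rep.
move=> [n]; elim: n r => [|n IH] r rJ.
  (* With bound 0 the image of the vacuum is zero, but its value at the empty word is (r, 0). *)
  by have [_ /(_ [::] isT)] := rJ vacuum; rewrite fock_R_vacuum; case.
suff : (J `&` @Delta R Q @^-1` [set 0]) r by rewrite J_ker.
split; first by apply: fock_K_R_J; exists n.+1.
apply/funext => q; apply: (psi_nondegenerate FS) => p.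
(* The scalar psi(p, r q) acts as S(p) sigma(r) T(q): the bound n + 1 applies at the vector T(q) f,
   and S(p) lowers it to n. *)
apply: IH => f; rewrite ST Tl.
exact: (fock_J_S p (rJ (fock_T q f))).
Qed.

(** Each T(q) S(p) ends with a creation, whose result vanishes at the empty word. *)
Lemma fock_pi_nil k (f : F) : F_PQ psi k ->
  fock_val (pi_TS psi fock_S fock_T k f) [::] = 0.
Proof.
move: k; apply: (pi_TS_ind psi_sys FS fock_rep
  (H := [set a : endo F | fock_val (a f) [::] = 0])) => //.
split=> // a b /= ha hb.
by rewrite -[LHS]/(fock_val (a f) [::] - fock_val (b f) [::]) ha hb subr0.
Qed.

Lemma fock_K_R_TS r k : F_PQ psi k ->
  fock_K (fock_R r - pi_TS psi fock_S fock_T k) -> J r.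
Proof.
move=> Fk [n /(_ vacuum)[/(_ [::])[x Jx]]] + _.
rewrite endoBE fock_valB fock_R_vacuum.
by rewrite fock_pi_nil // subr0; case=> ->.
Qed.

(** The level bound is 1: the relation lives on the empty word alone, where it multiplies by x, with
    result in the ideal J. *)
Lemma fock_K_relation x : J x -> F_PQ psi (Delta x) ->
  fock_K (fock_R x - pi_TS psi fock_S fock_T (Delta x)).
Proof.
move=> Jx Fx; exists 1%N => f; set a := fock_R x - _.
(* The value at [p :: s] is the value at [s] after S(p), and S(p) kills the relation. *)
have a0 p s : fock_val (a f) (p :: s) = 0.
  have := S_relation psi_sys FS fock_rep p Fx.
  by move=> /(congr1 (fun b : endo F => fock_val (b f) s)).
split=> -[|p s] //.
- exists (x ** (fock_val f [::]).1 + x *~ (fock_val f [::]).2).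
    have [Js JM] := J_ideal; apply: subgroupD => //; first exact: (JM _ _ Jx).2.
    exact: subgroup_mulrz.
  rewrite endoBE fock_valB.
  by rewrite fock_pi_nil // subr0.
- by exists 0; [case: J_ideal => -[] | rewrite a0].
Qed.

End IdealLevel.

End FockRepresentation.

(** * Gradings *)

Section Twist.
Variable B : rngType.

(* Multiplication by the Laurent monomial b t^n on sequences in B + Z. *)
Definition twist_fun (n : int) (b : B) (f : int -> B * int) : int -> B * int :=
  fun k => dact b (f (k - n)).

Fact twist_zmod n b : zmod_morphism (twist_fun n b).
Proof. by move=> f g; apply/funext => k; exact: dactBr. Qed.

Definition twist n b : endo (int -> B * int) := Endo (twist_zmod n b).

Lemma twistB n : zmod_morphism (twist n).
Proof. by move=> b c; apply: endoP => f; apply/funext => k; exact: dactBl. Qed.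

Lemma twistM m n b c : twist (m + n) (b ** c) = twist m b ** twist n c.
Proof.
apply: endoP => f; apply/funext => k.
by rewrite /= /twist_fun dactM opprD addrA.
Qed.

(** The constant Laurent polynomial 1; applying b t^n to it exhibits b as the coefficient in degree
    n. *)
Definition twist_unit : int -> B * int := fun k => if k == 0 then (0, 1) else 0.

Lemma twist_unitE n b k : twist n b twist_unit k = if k == n then (b, 0) else 0.
Proof.
rewrite /= /twist_fun /twist_unit subr_eq0; case: eqP => _; first exact: dact1.
by rewrite /dact /= rmulr0 mulr0z addr0.
Qed.

Section TwistRep.
Variables (R : rngType) (P Q : bimodType R) (psi : tensor P Q -> R).
Hypotheses (psi_sys : is_system psi) (FS : cond_FS psi).
Variables (S : P -> B) (T : Q -> B) (sigma : R -> B).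
Hypothesis rep : covariant_rep psi S T sigma.

(** All defining relations are homogeneous when S, T, sigma have degrees -1, 1, 0. *)
Lemma twist_rep :
  covariant_rep psi (twist (-1) \o S) (twist 1 \o T) (twist 0 \o sigma).
Proof.
have [SB TB [RB RM] Sr Sl Tr Tl ST] := rep.
split; try (apply: zmod_morphism_comp => //; exact: twistB).
- split; first by apply: zmod_morphism_comp => //; exact: twistB.
  by move=> x y; rewrite /= RM -twistM addr0.
- by move=> p r; rewrite /= Sr -twistM addr0.
- by move=> p r; rewrite /= Sl -twistM add0r.
- by move=> p r; rewrite /= Tr -twistM addr0.
- by move=> p r; rewrite /= Tl -twistM add0r.
- by move=> p q; rewrite /= ST -twistM addNr.
Qed.

(** T(q) S(p) has degree 0; hence the Cuntz-Pimsner relations are homogeneous too. *)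
Lemma pi_TS_twist k : F_PQ psi k ->
  pi_TS psi (twist (-1) \o S) (twist 1 \o T) k = twist 0 (pi_TS psi S T k).
Proof.
have [piB piM pith] := pi_TSP psi_sys FS rep.
have pi' := pi_TSP psi_sys FS twist_rep.
suff : is_pi psi (twist (-1) \o S) (twist 1 \o T) (twist 0 \o pi_TS psi S T).
  by move=> pi2 Fk; rewrite (is_pi_unique pi' pi2).
split=> [f g Ff Fg|f g Ff Fg|q p] /=.
- by rewrite piB // twistB.
- by rewrite piM // -twistM addr0.
- by rewrite pith -twistM addrN.
Qed.

Lemma twist_CP_invariant J : J `<=` @Delta R Q @^-1` F_PQ psi ->
  CP_invariant psi J S T sigma ->
  CP_invariant psi J (twist (-1) \o S) (twist 1 \o T) (twist 0 \o sigma).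
Proof. by move=> JF CP x Jx; rewrite pi_TS_twist ?CP //; apply: JF. Qed.

(* A homomorphism delta as below plays the role of a coaction of Z on B: the
   homogeneous elements of degree n are those with delta b = b t^n. *)
Lemma graded_of_twist (delta : B -> endo (int -> B * int)) :
  surjective_rep S T sigma -> rng_hom delta ->
  delta \o T = twist 1 \o T -> delta \o S = twist (-1) \o S ->
  delta \o sigma = twist 0 \o sigma -> graded_rep S T sigma.
Proof.
move=> surj [dB dM] dT dS dR; pose G n := [set b | delta b = twist n b].
have GR : range sigma `<=` G 0 by move=> _ [r _ <-]; apply: (congr1 (@^~ r) dR).
have GT : range T `<=` G 1 by move=> _ [r _ <-]; apply: (congr1 (@^~ r) dT).
have GS : range S `<=` G (-1) by move=> _ [r _ <-]; apply: (congr1 (@^~ r) dS).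
have Gs n : subgroup (G n).
  split=> [|x y]; rewrite /G /=.
    by rewrite (zmor0 dB) (zmor0 (twistB n)).
  by rewrite dB twistB => -> ->.
have GM m n x y : G m x -> G n y -> G (m + n) (x ** y).
  by rewrite /G /= dM twistM => -> ->.
exists G; split=> //; split=> // b.
have [d [Gd fd bE]] : exists d : int -> B, [/\ forall n, G n (d n),
    finite_set [set n | d n != 0] & b = \sum_(n \in [set: int]) d n].
  (* Sums of homogeneous elements form a subring containing the generators. *)
  apply: span_bigcup_fsum => //; move: b; apply: (rng_span_ind surj).
    apply: rng_span_mul => x y [m _ Gx] [n _ Gy].
    by apply: span_gen; exists (m + n) => //; apply: GM.
  move=> x [[]|] h; apply: span_gen.
  - by exists 0 => //; apply: GR.
  - by exists 1 => //; apply: GT.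
  - by exists (-1) => //; apply: GS.
exists d; split=> // d' [Gd' fd' bE'].
(* Uniqueness: the components of b are the coefficients of [delta b] at the unit sequence. *)
suff coeff (e : int -> B) : (forall n, G n (e n)) ->
    finite_set [set n | e n != 0] -> b = \sum_(n \in [set: int]) e n ->
    forall k, e k = (delta b twist_unit k).1.
  by apply/funext => k; rewrite (coeff d) // (coeff d').
move=> {d Gd fd bE d' Gd' fd' bE'} Ge fe -> k.
have [s us es] := finite_support_seq fe.
rewrite (fsum_seqE us es) (zmor_sum dB) endo_sumE fct_sumE.
under eq_bigr do rewrite Ge twist_unitE.
have [ks|ks] := boolP (k \in s).
  rewrite (bigD1_seq k) //= eqxx big1 ?addr0 // => n nk.
  by rewrite eq_sym (negbTE nk).
rewrite es // big_seq big1 // => n ns; case: eqP => // kn.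
by move: ks; rewrite kn ns.
Qed.

End TwistRep.

End Twist.

(** * The graded uniqueness theorem *)

Section GradedUniqueness.
Variables (R : rngType) (P Q : bimodType R) (psi : tensor P Q -> R).
Hypotheses (psi_sys : is_system psi) (FS : cond_FS psi).
Variables (A : rngType) (S : P -> A) (T : Q -> A) (sigma : R -> A).
Hypothesis rep : covariant_rep psi S T sigma.

Let SB : zmod_morphism S := rep_S rep.
Let TB : zmod_morphism T := rep_T rep.
Let sB : zmod_morphism sigma := proj1 (rep_sigma rep).
Let sM : {morph sigma : x y / x ** y} := proj2 (rep_sigma rep).

(** * Elements recovered by local units *)

Lemma left_faithful x : additive_span [set z | exists q y, z = T q ** y] x ->
  exists2 k, F_PQ psi k & pi_TS psi S T k ** x = x.
Proof.
(* A list of letters that a unit must fix is recorded instead of the unit: lists for two elements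
   can be concatenated. *)
suff h : forall x, additive_span [set z | exists q y, z = T q ** y] x ->
    exists qs : seq Q,
      forall e, {in qs, forall q, e ** T q = T q} -> e ** x = x.
  move=> /h[qs qsx]; have [k Fk kq] := left_units psi_sys FS rep qs.
  by exists k => //; apply: qsx.
apply: span_sub => [|_ [q [y ->]]]; last first.
  by exists [:: q] => e eq; rewrite rmulA eq ?mem_head.
split=> [|y z [qs hy] [qs' hz]]; first by exists [::] => e _; rewrite rmulr0.
exists (qs ++ qs') => e eq; rewrite rmulBr hy ?hz // => q qqs; apply: eq;
  by rewrite mem_cat qqs ?orbT.
Qed.

Lemma right_faithful x : additive_span [set z | exists p y, z = y ** S p] x ->
  exists2 k, F_PQ psi k & x ** pi_TS psi S T k = x.
Proof.
suff h : forall x, additive_span [set z | exists p y, z = y ** S p] x ->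
    exists ps : seq P,
      forall e, {in ps, forall p, S p ** e = S p} -> x ** e = x.
  move=> /h[ps psx]; have [k Fk kp] := right_units psi_sys FS rep ps.
  by exists k => //; apply: psx.
apply: span_sub => [|_ [p [y ->]]]; last first.
  by exists [:: p] => e ep; rewrite -rmulA ep ?mem_head.
split=> [|y z [ps hy] [ps' hz]]; first by exists [::] => e _; rewrite rmul0r.
exists (ps ++ ps') => e ep; rewrite rmulBl hy ?hz // => p pps; apply: ep;
  by rewrite mem_cat pps ?orbT.
Qed.

Lemma subgroup0 : subgroup [set (0 : A)].
Proof. by split=> // _ _ -> ->; rewrite subrr. Qed.

Lemma pi_TS_mull k x (H : set A) : subgroup H -> F_PQ psi k ->
  (forall q p, H (T q ** S p ** x)) -> H (pi_TS psi S T k ** x).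
Proof.
move=> Hs + h; move: k; apply: (pi_TS_ind psi_sys FS rep
  (H := [set a | H (a ** x)])) => //.
exact: (subgroup_preimage (@rmul_zmodr _ x) Hs).
Qed.

Lemma pi_TS_mulr k x (H : set A) : subgroup H -> F_PQ psi k ->
  (forall q p, H (x ** (T q ** S p))) -> H (x ** pi_TS psi S T k).
Proof.
move=> Hs + h; move: k; apply: (pi_TS_ind psi_sys FS rep
  (H := [set a | H (x ** a)])) => //.
exact: (subgroup_preimage (@rmul_zmodl _ x) Hs).
Qed.

(** With a local unit, x = pi(k) x is a sum of terms T(q) S(p) x. *)
Lemma left_faithful0 x : additive_span [set z | exists q y, z = T q ** y] x ->
  (forall p, S p ** x = 0) -> x = 0.
Proof.
move=> /left_faithful[k Fk kx] Sx; rewrite -kx.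
apply: (pi_TS_mull subgroup0 Fk) => q p.
by rewrite /= -rmulA Sx rmulr0.
Qed.

Lemma right_faithful0 x : additive_span [set z | exists p y, z = y ** S p] x ->
  (forall q, x ** T q = 0) -> x = 0.
Proof.
move=> /right_faithful[k Fk xk] xT; rewrite -xk.
apply: (pi_TS_mulr subgroup0 Fk) => q p.
by rewrite /= rmulA xT rmul0r.
Qed.

(* core n is the span of the T(Q)^k sigma(R) S(P)^k for k <= n, and below
   pos_part n and neg_part n are those of the T(Q)^(k+n) sigma(R) S(P)^k and of
   the T(Q)^k sigma(R) S(P)^(k+n) for all k. *)
Fixpoint core n : set A :=
  if n is m.+1 then
    [set x | exists r y, additive_span
       [set z | exists q c p, core m c /\ z = T q ** c ** S p] y /\
       x = sigma r + y]
  else range sigma.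

Lemma core_sigma n r : core n (sigma r).
Proof.
case: n => [|n]; first by exists r.
by exists r, 0; split; [apply: (subgroup_span _).1 | rewrite addr0].
Qed.

Lemma core_subgroup n : subgroup (core n).
Proof.
split; first by rewrite -(zmor0 sB); apply: core_sigma.
case: n => [|n] x x'.
  by move=> [r _ <-] [r' _ <-]; exists (r - r').
move=> [r [y [hy ->]]] [r' [y' [hy' ->]]]; exists (r - r'), (y - y').
split; first exact: (subgroup_span _).2.
by rewrite sB opprD addrACA.
Qed.

Lemma core_leq m n : (m <= n)%N -> core m `<=` core n.
Proof.
have step k : core k `<=` core k.+1.
  elim: k => [|k IH] x; first by move=> [r _ <-]; apply: core_sigma.
  move=> [r [y [hy ->]]]; exists r, y; split=> //.
  move: y hy; apply: span_sub; first exact: subgroup_span.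
  move=> _ [q [c [p [/IH hc ->]]]].
  by apply: span_gen; exists q, c, p.
move=> /subnK <-; elim: (n - m)%N => [|k IH] // x /IH.
exact: step.
Qed.

Lemma core_sigmal n r x : core n x -> core n (sigma r ** x).
Proof.
case: n => [|n]; first by move=> [r' _ <-]; exists (r ** r').
move=> [r' [y [hy ->]]]; exists (r ** r'), (sigma r ** y).
split; last by rewrite rmulDr sM.
move: y hy; apply: (span_sub
  (subgroup_preimage (@rmul_zmodl _ (sigma r)) (subgroup_span _))).
move=> _ [q [c [p [hc ->]]]]; apply: span_gen; exists (lact r q), c, p.
by rewrite !rmulA (rep_Tlact rep).
Qed.

Lemma core_sigmar n r x : core n x -> core n (x ** sigma r).
Proof.
case: n => [|n]; first by move=> [r' _ <-]; exists (r' ** r).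
move=> [r' [y [hy ->]]]; exists (r' ** r), (y ** sigma r).
split; last by rewrite rmulDl sM.
move: y hy; apply: (span_sub
  (subgroup_preimage (@rmul_zmodr _ (sigma r)) (subgroup_span _))).
move=> _ [q [c [p [hc ->]]]]; apply: span_gen; exists q, c, (ract p r).
by rewrite (rep_Sract rep) !rmulA.
Qed.

(** The outer factors meet a T(q') or an S(p') and collapse to scalars, so the words become
    shorter. *)
Lemma core_ST n p q x : core n.+1 x -> core n (S p ** x ** T q).
Proof.
move=> [r [y [hy ->]]]; rewrite rmulDr rmulDl.
apply: (subgroupD (core_subgroup n)).
  by rewrite -(rep_Sract rep) -(rep_psi rep); apply: core_sigma.
move: y hy; apply: (span_sub (subgroup_preimage
  (zmod_morphism_comp (@rmul_zmodl _ (S p)) (@rmul_zmodr _ (T q)))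
  (core_subgroup n))).
move=> _ [q' [c [p' [hc ->]]]] /=.
rewrite !rmulA -(rep_psi rep) -rmulA -(rep_psi rep).
by apply: core_sigmar; apply: core_sigmal.
Qed.

Definition core_union : set A := \bigcup_n core n.

Lemma core_union_subgroup : subgroup core_union.
Proof.
split; first by exists 0%N => //; apply: (core_subgroup 0).1.
move=> x y [m _ hx] [n _ hy]; exists (maxn m n) => //.
apply: (core_subgroup _).2.
  exact: (core_leq (leq_maxl m n)).
exact: (core_leq (leq_maxr m n)).
Qed.

Fixpoint pos_part n : set A :=
  if n is m.+1 then
    additive_span [set z | exists q c, pos_part m c /\ z = T q ** c]
  else core_union.

Fixpoint neg_part n : set A :=
  if n is m.+1 then
    additive_span [set z | exists p c, neg_part m c /\ z = c ** S p]
  else core_union.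

Arguments pos_part : simpl never.
Arguments neg_part : simpl never.

(** * Stability of the homogeneous parts under the generators *)

Lemma pos_part_subgroup n : subgroup (pos_part n).
Proof.
by case: n => [|n]; [exact: core_union_subgroup | exact: subgroup_span].
Qed.

Lemma neg_part_subgroup n : subgroup (neg_part n).
Proof.
by case: n => [|n]; [exact: core_union_subgroup | exact: subgroup_span].
Qed.

Lemma pos_part_sigmal n r x : pos_part n x -> pos_part n (sigma r ** x).
Proof.
case: n => [|n].
  by move=> [m _ hx]; exists m => //; apply: core_sigmal.
move: x; apply: (span_sub
  (subgroup_preimage (@rmul_zmodl _ (sigma r)) (subgroup_span _))).
move=> _ [q [c [hc ->]]]; apply: span_gen; exists (lact r q), c.
by rewrite rmulA (rep_Tlact rep).
Qed.

Lemma neg_part_sigmar n r x : neg_part n x -> neg_part n (x ** sigma r).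
Proof.
case: n => [|n].
  by move=> [m _ hx]; exists m => //; apply: core_sigmar.
move: x; apply: (span_sub
  (subgroup_preimage (@rmul_zmodr _ (sigma r)) (subgroup_span _))).
move=> _ [p [c [hc ->]]]; apply: span_gen; exists (ract p r), c.
by rewrite (rep_Sract rep) rmulA.
Qed.

Lemma neg_part_sigmal n r x : neg_part n x -> neg_part n (sigma r ** x).
Proof.
elim: n x => [|n IH] x; first exact: (pos_part_sigmal (n := 0)).
move: x; apply: (span_sub
  (subgroup_preimage (@rmul_zmodl _ (sigma r)) (subgroup_span _))).
move=> _ [p [c [hc ->]]]; apply: span_gen; exists p, (sigma r ** c).
by rewrite rmulA; split=> //; apply: IH.
Qed.

Lemma pos_part_T n q x : pos_part n x -> pos_part n.+1 (T q ** x).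
Proof. by move=> hx; apply: span_gen; exists q, x. Qed.

Lemma neg_part_S n p x : neg_part n x -> neg_part n.+1 (x ** S p).
Proof. by move=> hx; apply: span_gen; exists p, x. Qed.

Lemma pos_part_S n p x : pos_part n.+1 x -> pos_part n (S p ** x).
Proof.
move: x; apply: (span_sub
  (subgroup_preimage (@rmul_zmodl _ (S p)) (pos_part_subgroup n))).
move=> _ [q [c [hc ->]]] /=; rewrite rmulA -(rep_psi rep).
exact: pos_part_sigmal.
Qed.

Lemma neg_part_Tr n q x : neg_part n.+1 x -> neg_part n (x ** T q).
Proof.
move: x; apply: (span_sub
  (subgroup_preimage (@rmul_zmodr _ (T q)) (neg_part_subgroup n))).
move=> _ [p [c [hc ->]]] /=; rewrite -rmulA -(rep_psi rep).
exact: neg_part_sigmar.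
Qed.

Lemma neg_part_Tl n q x : neg_part n.+1 x -> neg_part n (T q ** x).
Proof.
have Hs m := subgroup_preimage (@rmul_zmodl _ (T q)) (neg_part_subgroup m).
elim: n x => [|n IH]; first apply: (span_sub (Hs 0%N)).
  move=> _ [p [c [[m _ hc] ->]]] /=; rewrite rmulA; exists m.+1 => //.
  exists 0, (T q ** c ** S p); split; last by rewrite (zmor0 sB) add0r.
  by apply: span_gen; exists q, c, p.
apply: (span_sub (Hs n.+1)) => _ [p [c [hc ->]]] /=; rewrite rmulA.
by apply: neg_part_S; apply: IH.
Qed.

(** A right factor in the core is supplied by a local unit: T(q) = pi(k) T(q), and T(q') S(p) T(q) =
    T(q') sigma(psi(p, q)). *)
Lemma T_pos_part q : pos_part 1 (T q).
Proof.
have [k Fk kq] := left_units psi_sys FS rep [:: q].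
rewrite -(kq q) ?mem_head //; apply: (pi_TS_mull (pos_part_subgroup 1) Fk).
move=> q' p; rewrite -rmulA -(rep_psi rep); apply: pos_part_T.
by exists 0%N => //; apply: core_sigma.
Qed.

Lemma S_neg_part p : neg_part 1 (S p).
Proof.
have [k Fk kp] := right_units psi_sys FS rep [:: p].
rewrite -(kp p) ?mem_head //; apply: (pi_TS_mulr (neg_part_subgroup 1) Fk).
move=> q p'; rewrite rmulA -(rep_psi rep); apply: neg_part_S.
by exists 0%N => //; apply: core_sigma.
Qed.

(** In degree 0, S(p) sigma(r) = S(p r), while S(p) T(q) c S(p') is a scalar times c S(p'). *)
Lemma neg_part_Sl n p x : neg_part n x -> neg_part n.+1 (S p ** x).
Proof.
have Hs m := subgroup_preimage (@rmul_zmodl _ (S p)) (neg_part_subgroup m).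
elim: n x => [|n IH] x; last first.
  move: x; apply: (span_sub (Hs n.+2)).
  move=> _ [p' [c [hc ->]]] /=; rewrite rmulA.
  by apply: neg_part_S; apply: IH.
move=> [[|m] _].
  by move=> [r _ <-]; rewrite -(rep_Sract rep); apply: S_neg_part.
move=> [r [y [hy ->]]]; rewrite rmulDr.
apply: (subgroupD (neg_part_subgroup 1)).
  by rewrite -(rep_Sract rep); apply: S_neg_part.
move: y hy; apply: (span_sub (Hs 1%N)).
move=> _ [q [c [p' [hc ->]]]] /=; rewrite !rmulA -(rep_psi rep).
by apply: neg_part_S; exists m => //; apply: core_sigmal.
Qed.

Definition homogeneous (n : int) : set A :=
  match n with Posz m => pos_part m | Negz m => neg_part m.+1 end.

Lemma homogeneous_subgroup n : subgroup (homogeneous n).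
Proof.
by case: n => n; [exact: pos_part_subgroup | exact: (neg_part_subgroup n.+1)].
Qed.

Lemma homogeneous_span : surjective_rep S T sigma ->
  forall x, additive_span (\bigcup_n homogeneous n) x.
Proof.
move=> surj; set Sp := additive_span _.
have Ss : subgroup Sp := subgroup_span _.
have pos n x : pos_part n x -> Sp x by move=> h; apply: span_gen; exists n%:Z.
have neg n x : neg_part n x -> Sp x.
  case: n => [|n] h; first exact: (pos 0%N).
  by apply: span_gen; exists (Negz n).
have lmul a : (forall n x, pos_part n x -> Sp (a ** x)) ->
    (forall n x, neg_part n.+1 x -> Sp (a ** x)) ->
    forall x, Sp x -> Sp (a ** x).
  move=> hp hn; apply: (span_sub (subgroup_preimage (@rmul_zmodl _ a) Ss)).
  by move=> x [[n|n] _]; [apply: hp | apply: hn].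
(* Joined with stability of the span under left multiplication by x, membership is preserved by the
   ring operations and can be checked on generators. *)
suff h x : Sp x /\ forall y, Sp y -> Sp (x ** y) by move=> x; case: (h x).
move: x; apply: (rng_span_ind surj); last first.
  move=> _ [[[r _ <-]|[q _ <-]]|[p _ <-]]; split.
  - by apply: (pos 0%N); exists 0%N => //; apply: core_sigma.
  - apply: lmul => n x hx; first exact: (pos _ _ (pos_part_sigmal r hx)).
    exact: (neg _ _ (neg_part_sigmal r hx)).
  - exact: (pos _ _ (T_pos_part q)).
  - apply: lmul => n x hx; first exact: (pos _ _ (pos_part_T q hx)).
    exact: (neg _ _ (neg_part_Tl q hx)).
  - exact: (neg _ _ (S_neg_part p)).
  - apply: lmul => [[|n] x hx|n x hx].
    + exact: (neg _ _ (neg_part_Sl (n := 0) p hx)).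
    + exact: (pos _ _ (pos_part_S p hx)).
    + exact: (neg _ _ (neg_part_Sl p hx)).
split; last first.
  move=> x y [hx xM] [hy yM]; split=> [|z hz]; first exact: xM.
  by rewrite -rmulA; exact: (xM _ (yM _ hz)).
split; first by split=> [|y _]; rewrite ?rmul0r; exact: Ss.1.
move=> x y [hx xM] [hy yM]; split=> [|z hz]; first exact: Ss.2.
by rewrite rmulBl; apply: Ss.2; [apply: xM | apply: yM].
Qed.

(** * The kernel of eta on homogeneous elements *)

Section Kernel.
Variables (B : rngType) (eta : A -> B) (J : set R).
Hypothesis eta_hom : rng_hom eta.
Hypothesis J_F : J `<=` @Delta R Q @^-1` F_PQ psi.
Hypothesis CP : CP_invariant psi J S T sigma.
Hypothesis inj : injective_rep (eta \o sigma).
Hypothesis J_max : J_rep psi (eta \o S) (eta \o T) (eta \o sigma) `<=` J.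

Let eB : zmod_morphism eta := proj1 eta_hom.
Let eM : {morph eta : x y / x ** y} := proj2 eta_hom.

Lemma rep_T_inj q : eta (T q) = 0 -> q = 0.
Proof.
move=> Tq; apply: (psi_nondegenerate FS) => p; apply: inj => /=.
by rewrite (rep_psi rep) eM Tq rmulr0 (zmor0 sB) (zmor0 eB).
Qed.

(** Since pi(k) T(q) = T(k(q)), injectivity of eta on T(Q) makes k vanish at every q. *)
Lemma pi_TS_kernel k : F_PQ psi k -> eta (pi_TS psi S T k) = 0 -> k = 0.
Proof.
move=> Fk ek; apply/funext => q; apply: rep_T_inj.
by rewrite -(pi_TS_T psi_sys FS rep) // eM ek rmul0r.
Qed.

Lemma span_TS_mul k k' r : F_PQ psi k -> F_PQ psi k' ->
  additive_span [set b | exists q p, b = T q ** S p]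
    (pi_TS psi S T k ** sigma r ** pi_TS psi S T k').
Proof.
move=> Fk Fk'; rewrite -rmulA; have Ss := subgroup_span.
apply: (pi_TS_mull (Ss _ _) Fk) => q p; rewrite !rmulA.
apply: (pi_TS_mulr (Ss _ _) Fk') => q' p'; apply: span_gen.
exists (ract q (psi (tpure (ract p r) q'))), p'.
by rewrite (rep_Tract rep) (rep_psi rep) (rep_Sract rep) !rmulA.
Qed.

Lemma core_kernel n x : core n x -> eta x = 0 -> x = 0.
Proof.
elim: n x => [|n IH] x.
  move=> [r _ <-] er; rewrite -(zmor0 sB); congr sigma; apply: inj.
  by rewrite /= er (zmor0 sB) (zmor0 eB).
move=> xc ex.
(* These compressions lie in the previous core and in the kernel, so the induction hypothesis
   applies. *)
have SxT p q : S p ** x ** T q = 0.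
  by apply: IH; [apply: core_ST | rewrite !eM ex rmulr0 rmul0r].
have [r [y [hy xE]]] := xc.
have [k Fk ky] : exists2 k, F_PQ psi k & pi_TS psi S T k ** y = y.
  apply: left_faithful; move: y hy {xE}; apply: span_sub.
    exact: subgroup_span.
  move=> _ [q [c [p [_ ->]]]]; apply: span_gen; exists q, (c ** S p).
  by rewrite rmulA.
have [k' Fk' yk'] : exists2 k, F_PQ psi k & y ** pi_TS psi S T k = y.
  apply: right_faithful; move: y hy {xE ky}; apply: span_sub.
    exact: subgroup_span.
  by move=> _ [q [c [p [_ ->]]]]; apply: span_gen; exists p, (T q ** c).
have kxk' : pi_TS psi S T k ** x ** pi_TS psi S T k' = 0.
  rewrite -rmulA; apply: (pi_TS_mull subgroup0 Fk) => q p.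
  rewrite rmulA; apply: (pi_TS_mulr subgroup0 Fk') => q' p' /=.
  rewrite !rmulA -[T q ** S p ** x]rmulA -[T q ** _ ** T q']rmulA.
  by rewrite SxT rmulr0 rmul0r.
(* Sandwiching x = sigma r + y between local units gives 0, so y is in the image
   of F_P(Q); then r is in J_(S,T,sigma,B), and x itself is in that image. *)
have [l Fl lE] : exists2 l, F_PQ psi l & pi_TS psi S T l = - y.
  apply: (span_pi_TS psi_sys FS rep).
  suff -> : - y = pi_TS psi S T k ** sigma r ** pi_TS psi S T k'.
    exact: span_TS_mul.
  apply/esym/eqP; rewrite -addr_eq0; apply/eqP.
  by rewrite -[in X in _ + X]yk' -{1}ky -rmulDl -rmulDr -xE.
have rJ : J r.
  apply: J_max; exists l => //.
  rewrite -(pi_TS_hom psi_sys FS eta_hom rep) // lE.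
  by apply/esym/eqP; rewrite /= -subr_eq0 -eB opprK -xE ex.
have FD := J_F rJ.
have Fkl : F_PQ psi (Delta r - l) by apply: (F_PQ_subgroup psi).2.
(* Invariance replaces sigma(r) by pi(Delta(r)), after which injectivity of eta on the image of pi
   finishes. *)
have xpi : x = pi_TS psi S T (Delta r - l).
  by rewrite (pi_TSB psi_sys FS rep) // CP // lE opprK.
rewrite xpi in ex *; rewrite (pi_TS_kernel Fkl ex).
by rewrite -(subrr (Delta r)) (pi_TSB psi_sys FS rep) // subrr.
Qed.

(** Multiplication by S(p) on the left, or by T(q) on the right, brings the degree one step closer
    to 0 inside the kernel. *)
Lemma homogeneous_kernel n x : homogeneous n x -> eta x = 0 -> x = 0.
Proof.
have pos m y : pos_part m y -> eta y = 0 -> y = 0.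
  elim: m y => [|m IH] y hy ey.
    by have [k _ hk] := hy; apply: (core_kernel hk).
  apply: left_faithful0.
    move: y hy {ey}; apply: span_sub; first exact: subgroup_span.
    by move=> _ [q [c [_ ->]]]; apply: span_gen; exists q, c.
  by move=> p; apply: IH; [apply: pos_part_S | rewrite eM ey rmulr0].
have neg m y : neg_part m y -> eta y = 0 -> y = 0.
  elim: m y => [|m IH] y hy ey; first exact: (pos 0%N).
  apply: right_faithful0.
    move: y hy {ey}; apply: span_sub; first exact: subgroup_span.
    by move=> _ [p [c [_ ->]]]; apply: span_gen; exists p, c.
  by move=> p; apply: IH; [apply: neg_part_Tr | rewrite eM ey rmul0r].
by case: n => n; [apply: pos | apply: neg].
Qed.

Lemma homogeneous_grading (G : int -> set B) :
  is_grading G -> range (eta \o sigma) `<=` G 0 ->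
  range (eta \o T) `<=` G 1 -> range (eta \o S) `<=` G (-1) ->
  forall n x, homogeneous n x -> G n (eta x).
Proof.
move=> [Gs _ GM] GR GT GS.
have gR r : G 0 (eta (sigma r)) by apply: GR; exists r.
have gT q : G 1 (eta (T q)) by apply: GT; exists q.
have gS p : G (-1) (eta (S p)) by apply: GS; exists p.
have gC n x : core n x -> G 0 (eta x).
  elim: n x => [|n IH] x; first by move=> [r _ <-].
  move=> [r [y [hy ->]]]; rewrite (zmorD eB); apply: (subgroupD (Gs 0)) => //.
  move: y hy; apply: (span_sub (subgroup_preimage eB (Gs 0))).
  move=> _ [q [c [p [/IH hc ->]]]] /=; rewrite !eM.
  rewrite -(subrr 1); apply: (GM _ _ _ _ _ (gS p)).
  by rewrite -[1]addr0; apply: GM.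
have pos n x : pos_part n x -> G n%:Z (eta x).
  elim: n x => [|n IH] x; first by move=> [m _ /gC].
  move: x; apply: (span_sub (subgroup_preimage eB (Gs _))).
  by move=> _ [q [c [/IH hc ->]]] /=; rewrite eM intS; apply: GM.
have neg n x : neg_part n x -> G (- n%:Z) (eta x).
  elim: n x => [|n IH] x; first exact: (pos 0%N).
  move: x; apply: (span_sub (subgroup_preimage eB (Gs _))).
  move=> _ [p [c [/IH hc ->]]] /=.
  by rewrite eM intS opprD addrC; apply: GM.
by case=> n x; [apply: pos | rewrite NegzE; apply: neg].
Qed.

Lemma graded_uniqueness : surjective_rep S T sigma ->
  graded_rep (eta \o S) (eta \o T) (eta \o sigma) -> injective eta.
Proof.
move=> surj [G [Ggr GR GT GS]].
suff ker0 x : eta x = 0 -> x = 0.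
  move=> x y exy; apply/eqP; rewrite -subr_eq0; apply/eqP/ker0.
  by rewrite eB exy subrr.
move=> ex.
have [d [hd fd xE]] :=
  span_bigcup_fsum homogeneous_subgroup (homogeneous_span surj x).
have [s us ds] := finite_support_seq fd.
(* In B both the zero family and [eta \o d] decompose 0, so every component of x lies in the
   kernel. *)
have [Gs Guniq _] := Ggr; have [d0 [_ d0uniq]] := Guniq 0.
have e0 : d0 = fun=> 0.
  apply: d0uniq; split.
  - by move=> n; apply: (Gs n).1.
  - by apply: (@sub_finite_set _ _ set0) => // n /=; rewrite eqxx.
  - by rewrite fsbig1.
have e1 : d0 = eta \o d.
  apply: d0uniq; split.
  - by move=> n; apply: (homogeneous_grading Ggr GR GT GS).
  - apply: (sub_finite_set _ fd) => n /=; apply: contraNneq => ->.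
    by rewrite (zmor0 eB).
  - rewrite -[LHS]ex xE (fsum_seqE us ds) (zmor_sum eB) (fsum_seqE us) //.
    by move=> n ns /=; rewrite ds // (zmor0 eB).
rewrite xE fsbig1 // => n _; apply: (homogeneous_kernel (hd n)).
by have := congr1 (@^~ n) e1; rewrite e0.
Qed.

End Kernel.

End GradedUniqueness.

(** * The Cuntz-Pimsner ring *)

Section CuntzPimsner.
Variables (R : rngType) (P Q : bimodType R) (psi : tensor P Q -> R).
Hypotheses (psi_sys : is_system psi) (FS : cond_FS psi).
Variables (A : rngType) (iP : P -> A) (iQ : Q -> A) (iR : R -> A).
Hypothesis toeplitzA : is_toeplitz psi iP iQ iR.
Variable J : set R.
Hypothesis J_F : J `<=` @Delta R Q @^-1` F_PQ psi.

Let repA : covariant_rep psi iP iQ iR := let: And3 h _ _ := toeplitzA in h.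
Let surjA : surjective_rep iP iQ iR := let: And3 _ h _ := toeplitzA in h.

Local Notation O := (CP_ring psi iP iQ iR J).
Local Notation jP := (iota_P psi iP iQ iR J).
Local Notation jQ := (iota_Q psi iP iQ iR J).
Local Notation jR := (iota_R psi iP iQ iR J).

Let rho_hom : rng_hom (rho psi iP iQ iR J).
Proof. exact: to_quot_hom. Qed.

Lemma CP_rep : covariant_rep psi jP jQ jR.
Proof. exact: covariant_rep_hom. Qed.

Lemma CP_rep_surjective : surjective_rep jP jQ jR.
Proof.
have := rng_span_hom rho_hom surjA (fun x => ex_intro _ _ (to_quotK x)).
by rewrite /surjective_rep !image_setU !image_comp.
Qed.

Lemma CP_rep_invariant : CP_invariant psi J jP jQ jR.
Proof.
move=> x Jx; rewrite -(pi_TS_hom psi_sys FS rho_hom repA); last exact: J_F.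
apply/esym/to_quot_eq.
by move=> I [_]; apply; exists x.
Qed.

Lemma CP_lift (B : rngType) (S : P -> B) (T : Q -> B) (sigma : R -> B) :
  covariant_rep psi S T sigma -> CP_invariant psi J S T sigma ->
  exists eta : O -> B,
    [/\ rng_hom eta, eta \o jQ = T, eta \o jP = S & eta \o jR = sigma].
Proof.
move=> rep CP; have [_ _ univ] := toeplitzA.
have [phi [[phi_hom phiR phiQ phiP] _]] := univ B S T sigma rep.
have [phiB phiM] := phi_hom.
(* On J, phi sends iota_R(y) to sigma(y) and pi(Delta(y)) to pi_{T,S}(Delta(y)), which agree by
   invariance; so phi kills T(J). *)
have phi0 x : ideal_span (CP_relations psi iP iQ iR J) x -> phi x = 0.
  apply: (smallest_sub (X := [set x | phi x = 0])).
    split; first split=> [|y z /= hy hz]; first by rewrite /= (zmor0 phiB).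
      by rewrite phiB hy hz subrr.
    by move=> a y /= hy; rewrite !phiM hy rmulr0 rmul0r.
  move=> _ [y Jy <-] /=; rewrite phiB (pi_TS_hom psi_sys FS phi_hom repA).
    by rewrite phiP phiQ CP // -[phi _]/((phi \o iR) y) phiR subrr.
  exact: J_F.
pose eta (x : O) := phi (repr x).
have etaE a : eta (rho psi iP iQ iR J a) = phi a.
  apply/eqP; rewrite -subr_eq0 -phiB; apply/eqP/phi0/to_quot_eq.
  exact: to_quotK.
have rhoK (x : O) : rho psi iP iQ iR J (repr x) = x by apply: to_quotK.
exists eta; split.
- split=> x y; rewrite -[x]rhoK -[y]rhoK.
    by rewrite -(proj1 rho_hom) !etaE phiB.
  by rewrite -(proj2 rho_hom) !etaE phiM.
- by rewrite -phiQ; apply/funext => q; apply: etaE.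
- by rewrite -phiP; apply/funext => q; apply: etaE.
- by rewrite -phiR; apply/funext => q; apply: etaE.
Qed.

Lemma CP_hom_unique (B : rngType) (S : P -> B) (T : Q -> B) (sigma : R -> B)
    (eta eta' : O -> B) :
  [/\ rng_hom eta, eta \o jQ = T, eta \o jP = S & eta \o jR = sigma] ->
  [/\ rng_hom eta', eta' \o jQ = T, eta' \o jP = S & eta' \o jR = sigma] ->
  eta = eta'.
Proof.
move=> [eh <- <- <-] [eh' eQ eP eR].
apply: (rng_hom_ext CP_rep_surjective) => //.
move=> _ [[[r _ <-]|[q _ <-]]|[p _ <-]].
- exact/esym/(congr1 (@^~ r) eR).
- exact/esym/(congr1 (@^~ q) eQ).
- exact/esym/(congr1 (@^~ p) eP).
Qed.

(** * Injectivity of iota_R^J and maximality of J *)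

Section Faithful.
Hypothesis J_ideal : two_sided_ideal J.
Hypothesis J_ker : J `&` @Delta R Q @^-1` [set 0] = [set 0].

(** Gives a necessary condition for membership in T(J), hence for equality in the quotient. *)
Lemma CP_ideal_fock : exists phi : A -> endo (fock P),
  [/\ rng_hom phi, phi \o iR = @fock_R R P, phi \o iQ = fock_T psi_sys,
      phi \o iP = @fock_S R P
    & forall x, ideal_span (CP_relations psi iP iQ iR J) x -> fock_K J (phi x)].
Proof.
have [_ _ univ] := toeplitzA.
have [phi [[phi_hom phiR phiQ phiP] _]] := univ _ _ _ _ (fock_rep psi_sys).
have [phiB phiM] := phi_hom; exists phi; split=> //.
have bounded a : fock_bounded J (phi a).
  move: a; apply: (rng_span_ind surjA).
    have [bs bM] := fock_bounded_subrng P J_ideal.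
    split; first exact: subgroup_preimage.
    by move=> x y; rewrite /= phiM; apply: bM.
  move=> x hx; apply: (fock_bounded_gen (psi_sys := psi_sys) J_ideal).
  rewrite -phiR -phiQ -phiP; case: hx => [[[r _ <-]|[q _ <-]]|[p _ <-]].
  - by left; left; exists r.
  - by left; right; exists q.
  - by right; exists p.
apply: (smallest_sub (X := phi @^-1` fock_K J)).
  split; first exact: (subgroup_preimage phiB (fock_K_subgroup P J_ideal)).
  move=> a x hx; rewrite /= !phiM.
  by split; [apply: fock_K_mull | apply: fock_K_mulr].
move=> _ [x Jx <-].
rewrite /= phiB (pi_TS_hom psi_sys FS phi_hom repA); last exact: J_F.
rewrite phiP phiQ -[phi _]/((phi \o iR) x) phiR.
by apply: fock_K_relation => //; apply: J_F.
Qed.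

Lemma iota_R_injective : injective_rep jR.
Proof.
have [phi [phi_hom phiR _ _ phiK]] := CP_ideal_fock.
move=> r r' /to_quot_eq /phiK.
rewrite -(proj1 (rep_sigma repA)) -[phi _]/((phi \o iR) _) phiR.
by move=> /(fock_K_R0 psi_sys FS J_ker)/eqP; rewrite subr_eq0 => /eqP.
Qed.

Lemma J_rep_CP : J_rep psi jP jQ jR = J.
Proof.
apply/seteqP; split=> [r [k Fk]|r Jr]; last first.
  by exists (Delta r); [apply: J_F | apply: CP_rep_invariant].
have [phi [phi_hom phiR phiQ phiP phiK]] := CP_ideal_fock.
rewrite -(pi_TS_hom psi_sys FS rho_hom repA) // => /esym/to_quot_eq/phiK.
rewrite (proj1 phi_hom) (pi_TS_hom psi_sys FS phi_hom repA) // phiP phiQ.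
rewrite -[phi _]/((phi \o iR) _) phiR.
exact: fock_K_R_TS.
Qed.

End Faithful.

End CuntzPimsner.

(** * Homomorphisms out of O(J) and the isomorphism criterion *)

Theorem theorem3p29 (R : rngType) (P Q : bimodType R) (psi : tensor P Q -> R)
  (psi_sys : is_system psi) (FS : cond_FS psi)
  (A : rngType) (iP : P -> A) (iQ : Q -> A) (iR : R -> A)
  (toeplitzA : is_toeplitz psi iP iQ iR)
  (J : set R) (J_ideal : two_sided_ideal J)
  (J_F : J `<=` @Delta R Q @^-1` F_PQ psi)
  (J_ker : J `&` @Delta R Q @^-1` [set 0] = [set 0])
  (B : rngType) (S : P -> B) (T : Q -> B) (sigma : R -> B)
  (rep : covariant_rep psi S T sigma) :
  let is_eta (eta : CP_ring psi iP iQ iR J -> B) :=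
    [/\ rng_hom eta,
        eta \o iota_Q psi iP iQ iR J = T,
        eta \o iota_P psi iP iQ iR J = S
      & eta \o iota_R psi iP iQ iR J = sigma] in
  [/\ (exists eta, is_eta eta) -> CP_invariant psi J S T sigma,
      CP_invariant psi J S T sigma -> exists! eta, is_eta eta
    & CP_invariant psi J S T sigma ->
      forall eta, is_eta eta ->
        (bijective eta <->
         [/\ surjective_rep S T sigma, injective_rep sigma,
             graded_rep S T sigma & J = J_rep psi S T sigma])].
Proof.
move=> is_eta.
have CPrep := CP_rep toeplitzA J.
split.
- move=> [eta [eh <- <- <-]] x Jx.
  rewrite -(pi_TS_hom psi_sys FS eh CPrep); last exact: J_F.
  by rewrite (CP_rep_invariant psi_sys FS toeplitzA J_F).
- move=> CP; have [eta etaP] := CP_lift psi_sys FS toeplitzA J_F rep CP.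
  exists eta; split=> // eta' eta'P.
  exact: (CP_hom_unique toeplitzA etaP eta'P).
move=> CP eta etaP; have [eh eQ eP eR] := etaP; have [eB eM] := eh; split.
- case=> inv etaK invK.
  have surj : surjective_rep S T sigma.
    have := rng_span_hom eh (CP_rep_surjective toeplitzA J)
      (fun b => ex_intro _ _ (invK b)).
    by rewrite /surjective_rep !image_setU !image_comp eQ eP eR.
  have inv_hom : rng_hom inv.
    split=> x y; apply: (can_inj etaK); first by rewrite eB !invK.
    by rewrite eM !invK.
  split=> //.
  + rewrite /injective_rep -eR => r r' /(can_inj etaK).
    exact: (iota_R_injective psi_sys FS toeplitzA J_F J_ideal J_ker).
  (* The twisted representation is again invariant, so part (2) lifts it to O(J); composing with the
     inverse of eta gives the coaction on B. *)
  + have [delta [dh dQ dP dR]] := CP_lift psi_sys FS toeplitzA J_F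
      (twist_rep rep) (twist_CP_invariant psi_sys FS rep J_F CP).
    have dE (X : Type) (f : X -> CP_ring psi iP iQ iR J) (g : X -> B) :
        eta \o f = g -> (delta \o inv) \o g = delta \o f.
      by move=> <-; apply/funext => x /=; rewrite etaK.
    apply: (graded_of_twist surj (rng_hom_comp inv_hom dh)).
    * by rewrite (dE _ _ _ eQ).
    * by rewrite (dE _ _ _ eP).
    * by rewrite (dE _ _ _ eR).
  (* An isomorphism carries sigma and pi along, so both representations have the same maximal
     ideal. *)
  + apply/esym; rewrite -[RHS](J_rep_CP psi_sys FS toeplitzA J_F J_ideal).
    apply/seteqP; split=> r [k Fk kr]; exists k => //.
      apply: (can_inj etaK); rewrite (pi_TS_hom psi_sys FS eh CPrep) //.
      by rewrite eP eQ kr -eR.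
    by rewrite -eP -eQ -(pi_TS_hom psi_sys FS eh CPrep) // kr -eR.
- case=> surj inj gr JE.
  (* Graded uniqueness is applied to O(J) with its canonical representation. *)
  have eta_inj : injective eta.
    apply: (graded_uniqueness psi_sys FS CPrep eh J_F
      (CP_rep_invariant psi_sys FS toeplitzA J_F)).
    + by rewrite eR.
    + by rewrite eP eQ eR -JE.
    + exact: (CP_rep_surjective toeplitzA).
    + by rewrite eP eQ eR.
  (* The image of eta is a subring containing the generators of B. *)
  have eta_surj b : exists x, eta x = b.
    move: b; apply: (rng_span_ind surj); last first.
      move=> _ [[[r _ <-]|[q _ <-]]|[p _ <-]].
      - by exists (iota_R psi iP iQ iR J r); rewrite -eR.
      - by exists (iota_Q psi iP iQ iR J q); rewrite -eQ.
      - by exists (iota_P psi iP iQ iR J p); rewrite -eP.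
    split; last by move=> _ _ [x <-] [y <-]; exists (x ** y); rewrite eM.
    split; first by exists 0; rewrite (zmor0 eB).
    by move=> _ _ [x <-] [y <-]; exists (x - y); rewrite eB.
  have [inv invK] := choice eta_surj.
  by exists inv => // x; apply: eta_inj; rewrite invK.
Qed.
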